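(* For each integer $n\ge 2$, let $\sigma$ and $\pi$ be two independent uniformly random permutations of $[n]=\{1,\dots,n\}$. Then, as $n\to\infty$, \[ \mathbb{E}\left[U(\sigma,\pi)\right] = O\left( n^{1/3}\log^{11/6}(n)\right), \] i.e. there is an absolute constant $C>0$ such that $\mathbb{E}[U(\sigma,\pi)] \le C\, n^{1/3}\log^{11/6}(n)$ for all sufficiently large $n$.
   Context: A permutation $\sigma\in S_n$ is written as the sequence $\sigma(1),\sigma(2),\dots,\sigma(n)$. The pattern of a sequence $a_1,\dots,a_m$ of distinct real numbers is the permutation in $S_m$ obtained by replacing the $i$th smallest element of the sequence by $i$, for each $i$. Two sequences of distinct real numbers of the same length are order-isomorphic, written $\mathbf{a}\sim\mathbf{b}$, if they have the same pattern. Two permutations $\sigma,\pi\in S_n$ are $\ell$-similar if the sequences $\sigma(1),\dots,\sigma(n)$ and $\pi(1),\dots,\pi(n)$ can be partitioned into (not necessarily contiguous) subsequences $\sigma^{(1)},\dots,\sigma^{(\ell)}$ and $\pi^{(1)},\dots,\pi^{(\ell)}$ respectively such that $\sigma^{(i)}\sim\pi^{(i)}$ for each $i\in[\ell]$. $U(\sigma,\pi)$ denotes the smallest $\ell$ for which $\sigma$ and $\pi$ are $\ell$-similar. Here $\log^{a}(n)$ denotes $(\log n)^a$. *)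

(* Defs.v *)
From HB Require Import structures.
From mathcomp Require Import all_boot all_order all_algebra all_fingroup.
From mathcomp Require Import all_classical all_reals all_analysis.

Set Implicit Arguments.
Unset Strict Implicit.
Unset Printing Implicit Defensive.

Import Order.TTheory GRing.Theory Num.Theory.

(* The pattern in one-line notation, with values 1, ..., size a. It is meant
   for sequences of distinct elements. *)
Definition pattern (d : Order.disp_t) (T : orderType d) (a : seq T) : seq nat :=
  [seq (index x (sort <=%O a)).+1 | x <- a].

(* Equal patterns have equal sizes, so no length condition is needed. *)
Definition order_iso (d d' : Order.disp_t) (T : orderType d) (T' : orderType d')
  (a : seq T) (b : seq T') : bool := pattern a == pattern b.

(* A partition into l subsequences is given by a colouring f of the positions;
   part i collects, in increasing order of position, the values at the
   positions of colour i. *)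
Definition subseq_of (n l : nat) (s : 'S_n) (f : {ffun 'I_n -> 'I_l})
  (i : 'I_l) : seq 'I_n := [seq s j | j <- enum 'I_n & f j == i].

(* Colour classes may be empty. This does not affect the smallest l: a part
   that is empty on one side is empty on both sides and can be dropped. *)
Definition similar (n l : nat) (s p : 'S_n) : bool :=
  [exists f : {ffun 'I_n -> 'I_l}, exists g : {ffun 'I_n -> 'I_l},
    forall i : 'I_l, order_iso (subseq_of s f i) (subseq_of p g i)].

Lemma similar_ex (n : nat) (s p : 'S_n) : exists l, similar l s p.
Proof.
exists n; apply/existsP; exists [ffun i => i]; apply/existsP.
exists [ffun i => i]; apply/forallP => i.
have E (t : 'S_n) : subseq_of t [ffun i => i] i = [:: t i].
  rewrite /subseq_of (eq_filter (a2 := pred1 i)); last by move=> j; rewrite ffunE.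
  by rewrite filter_pred1_uniq ?enum_uniq ?mem_enum.
by rewrite /order_iso /pattern !E /= !eqxx.
Qed.

Definition U (n : nat) (s p : 'S_n) : nat := ex_minn (similar_ex s p).

Local Open Scope ring_scope.

Definition unif_pmf (R : realType) (T : finType) : T -> R :=
  fun=> #|T|%:R^-1.

(* Joint law of two independent variables with laws P and Q. *)
Definition indep_pmf (R : realType) (S T : finType) (P : S -> R) (Q : T -> R) :
  S * T -> R := fun w => P w.1 * Q w.2.

Definition expect (R : realType) (T : finType) (P : T -> R) (X : T -> R) : R :=
  \sum_(w : T) P w * X w.

Definition expected_U (R : realType) (n : nat) : R :=
  expect (indep_pmf (@unif_pmf R 'S_n) (@unif_pmf R 'S_n))
         (fun w => (U w.1 w.2)%:R).

(* Main.v *)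
(* Write L = ln n.  A bijection [phi] between the positions of [s] and those of [p] turns every set
   of positions on which both the horizontal and the vertical displacement lie in fixed intervals
   of length W, and whose points are pairwise W-separated in both coordinates, into a pair of
   order-isomorphic subsequences.  So it suffices to find [phi] with all displacements at most D
   such that, for every displacement class, few points fall in any strip of width W: a greedy
   colouring of the conflict graph then uses O((D/W)^2 L) colours.

   Halving the point set of each permutation alternately by position and by value yields cells
   with the same cardinalities for [s] and [p].  By Chernoff bounds over all rectangles each
   halving moves the cut by O(sqrt (n L)) from the ideal dyadic position, so stopping at cells of
   about m = L^4 points leaves corresponding cells within D = O(sqrt (n m)) of each other.  Match
   corresponding cells by a random bijection: a prescribed set of t pairs is then matched with
   probability at most about (n^2 m)^(-t), which makes strips with more than t = O(L) points in
   one class unlikely as soon as W^3 is a small multiple of n m L.  The number of colours is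
   O((n m)^(1/3) L^(1/3)) = O(n^(1/3) L^(5/3)). *)

Require Import Defs.
From HB Require Import structures.
From mathcomp Require Import all_boot all_order all_algebra all_fingroup.
From mathcomp Require Import all_classical all_reals all_analysis.
From mathcomp Require Import ring lra zify.

Import Order.TTheory GRing.Theory Num.Theory.
Import numFieldNormedType.Exports.

Set Implicit Arguments.
Unset Strict Implicit.
Unset Printing Implicit Defensive.

Local Open Scope ring_scope.

(** * Colour classes as order-isomorphic parts *)

(** Sorting [A] by [f] and sorting it by [g] give the same list, so each element has the same rank
    in both images. *)
Lemma pattern_map (d : Order.disp_t) (T : orderType d) (I : eqType) (f g : I -> T) (A : seq I) :
  {in A &, injective f} -> {in A &, injective g} ->
  {in A &, forall x y, (f x < f y)%O = (g x < g y)%O} ->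
  pattern [seq f x | x <- A] = pattern [seq g x | x <- A].
Proof.
move=> fI gI fg.
have fg' : {in A &, forall x y, (f x <= f y)%O = (g x <= g y)%O}.
  by move=> x y xA yA; rewrite !leNgt fg.
rewrite /pattern !sort_map.
set sf := sort (relpre f <=%O) A; set sg := sort (relpre g <=%O) A.
have -> : sf = sg.
  apply: (@sorted_eq_in _ (relpre f <=%O)).
  - move=> y x z _ _ _ /=; exact: le_trans.
  - move=> x y; rewrite !mem_sort => xA yA /= /le_anti; exact: fI.
  - by apply: sort_sorted => x y /=; exact: le_total.
  - have ee : {in mem A &, relpre f <=%O =2 relpre g <=%O} by exact: fg'.
    rewrite (eq_in_sorted ee); last by apply/allP => x; rewrite mem_sort.
    by apply: sort_sorted => x y /=; exact: le_total.
  - by rewrite perm_sort perm_sym perm_sort.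
rewrite -!map_comp; apply/eq_in_map => x xA /=; congr _.+1.
have idx (h : I -> T) : {in A &, injective h} -> index (h x) (map h sg) = index x sg.
  move=> hI; have sA : {subset sg <= A} by move=> z; rewrite mem_sort.
  elim: sg sA => //= y s IH sA.
  have yA : y \in A by apply: sA; rewrite mem_head.
  rewrite (inj_in_eq hI) // IH // => z zs; apply: sA; by rewrite inE zs orbT.
by rewrite !idx.
Qed.

(** The parts are the colour classes on the side of [s] and their images under [phi] on the side of
    [p]. Since [phi] is increasing on a class, it lists the image in order of position; the second
    hypothesis then compares the values. *)
Lemma U_le_card (n : nat) (C : finType) (s p phi : 'S_n) (col : 'I_n -> C) :
  (forall x y, col x = col y -> (x < y)%O = (phi x < phi y)%O) ->
  (forall x y, col x = col y -> (s x < s y)%O = (p (phi x) < p (phi y))%O) ->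
  (U s p <= #|C|)%N.
Proof.
move=> hx hy; rewrite /U; case: ex_minnP => m _; apply.
apply/existsP; exists [ffun x => enum_rank (col x)].
apply/existsP; exists [ffun y => enum_rank (col (phi^-1 y)%g)].
apply/forallP => i; rewrite /order_iso; apply/eqP.
rewrite /subseq_of.
set A := [seq j <- enum 'I_n | [ffun x => enum_rank (col x)] j == i].
have AP x : x \in A -> col x = enum_val i.
  by rewrite mem_filter ffunE => /andP[/eqP ij _]; rewrite -ij enum_rankK.
have -> : [seq j <- enum 'I_n | [ffun y => enum_rank (col ((phi^-1)%g y))] j == i]
    = map phi A.
  have srt : sorted <%O (enum 'I_n : seq 'I_n).
    have := ltn_sorted_uniq_leq (map val (enum 'I_n)).
    rewrite val_enum_ord iota_ltn_sorted => _.
    have := iota_ltn_sorted 0 n; rewrite -val_enum_ord sorted_map.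
    by apply: sub_sorted => a b.
  apply: (@irr_sorted_eq _ <%O).
  - exact: lt_trans.
  - exact: ltxx.
  - by apply: sorted_filter => //; exact: lt_trans.
  - rewrite sorted_map.
    have ee : {in mem A &, relpre phi <%O =2 <%O}.
      by move=> x y /AP xA /AP yA /=; rewrite -hx // xA yA.
    rewrite (eq_in_sorted ee); last exact/allP.
    by apply: sorted_filter => //; exact: lt_trans.
  - move=> y; apply/idP/mapP.
    + rewrite mem_filter ffunE => /andP[/eqP ij _]; exists (phi^-1 y)%g; last by rewrite permKV.
      by rewrite mem_filter ffunE mem_enum ij eqxx.
    + move=> [x]; rewrite mem_filter ffunE => /andP[/eqP ij _] ->; rewrite mem_filter ffunE.
      by rewrite permK ij eqxx mem_enum.
rewrite -map_comp; apply: pattern_map.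
- by move=> x y _ _; exact: perm_inj.
- by move=> x y _ _ /= /perm_inj /perm_inj.
- by move=> x y /AP xA /AP yA /=; rewrite hy // xA yA.
Qed.

(** Vertices are coloured one at a time; fewer than [d] neighbours block fewer than [d] colours. *)
Lemma greedy_colouring (T : finType) (e : rel T) (d : nat) :
  symmetric e -> (forall x, (#|[set y | e x y]| < d)%N) ->
  exists col : T -> 'I_d, forall x y, x != y -> e x y -> col x != col y.
Proof.
move=> es ed.
suff H (s : seq T) : uniq s -> exists col : T -> 'I_d,
    {in s &, forall x y, x != y -> e x y -> col x != col y}.
  have [col colP] := H (enum T) (enum_uniq _).
  by exists col => x y; apply: colP; rewrite mem_enum.
elim: s => [_|z s IH /= /andP[zs us]].
  by exists (fun x => Ordinal (leq_ltn_trans (leq0n _) (ed x))).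
have [col colP] := IH us.
have : (0 < #|~: [set col y | y in [set y | e z y]]|)%N.
  rewrite cardsCs card_ord finset.setCK subn_gt0.
  by apply: leq_ltn_trans (ed z); exact: leq_imset_card.
rewrite card_gt0 => /set0Pn[c]; rewrite inE => /imsetP cz.
exists (fun x => if x == z then c else col x) => x y.
rewrite !inE; case: eqVneq => [->|xz] /=; case: eqVneq => [->|yz] //=.
- move=> _ ys _ ezy; apply/eqP => cE; apply: cz; by exists y; rewrite ?inE.
- move=> xs _ _ exz; apply/eqP => cE; apply: cz; by exists x; rewrite ?inE 1?es.
- exact: colP.
Qed.

(** * Prescribed values and factorial moments *)

(** The bijections that carry each class of [f] onto the class of [g] with the same label, that is,
    the matchings of corresponding cells. *)
Definition relabellings (n : nat) (K : eqType) (f g : 'I_n -> K) : {set 'S_n} :=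
  [set tau : 'S_n | [forall x, g (tau x) == f x]].

(* Right multiplication by the transpositions that move the last prescribed value inside its
   fibre disperses one extra constraint over [m - size ks] values. *)
Lemma card_relabellings_prescribed (n m : nat) (K : eqType) (f g : 'I_n -> K)
    (ks : seq ('I_n * 'I_n)) :
  (forall y, (m <= #|[set j | g j == g y]|)%N) -> uniq (unzip1 ks) ->
  (#|[set tau in relabellings f g | all (fun z => tau z.1 == z.2) ks]| * m ^_ (size ks)
     <= #|relabellings f g|)%N.
Proof.
move=> fib; elim: ks => [_|z ks IH /= /andP[zks uks]].
  by rewrite ffactn0 muln1; apply: subset_leq_card; apply/fintype.subsetP => t; rewrite inE => /andP[].
apply: leq_trans (IH uks); rewrite ffactnSr mulnCA mulnC leq_mul2r; apply/orP; right.
set A := [set tau in _ | (_ == _) && _].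
(* Values in the fibre of [z.2] that no remaining constraint uses: swapping [z.2] with one of them
   keeps those constraints and the labels. *)
set B := [set j | (g j == g z.2) && (j \notin unzip2 ks)].
have cB : (m - size ks <= #|B|)%N.
  have -> : B = [set j | g j == g z.2] :\: [set j in unzip2 ks].
    by apply/setP => j; rewrite !inE andbC.
  rewrite cardsD leq_sub // ?fib //.
  apply: (leq_trans (subset_leq_card (subsetIr _ _))).
  by rewrite cardsE -(size_map snd); exact: card_size.
apply: (@leq_trans (#|A| * #|B|)%N); first by rewrite leq_mul2l cB orbT.
rewrite -cardsX.
have inj : {in finset.setX A B &, injective (fun w : 'S_n * 'I_n => w.1 * tperm z.2 w.2)%g}.
  move=> [t j] [t' j']; rewrite !inE /= => /andP[/andP[_ /andP[/eqP tz _]] _].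
  move=> /andP[/andP[_ /andP[/eqP tz' _]] _] e.
  have jj : j = j'.
    by have /permP/(_ z.1) := e; rewrite !permM tz tz' !tpermL.
  by rewrite -jj in e *; move/mulIg: e => ->.
rewrite -(card_in_imset inj); apply: subset_leq_card; apply/fintype.subsetP => _ /imsetP[[t j] + ->].
rewrite !inE /= => /andP[/andP[/forallP tG /andP[/eqP tz /allP tks]] /andP[/eqP gj jks]].
apply/andP; split.
  apply/forallP => x; rewrite permM -(eqP (tG x)).
  by case: tpermP => // ->; rewrite ?gj.
apply/allP => w wks; rewrite permM (eqP (tks w wks)) tpermD //.
  apply: contraNneq zks => zw; apply/mapP; exists w => //.
  by apply: (@perm_inj _ t); rewrite tz (eqP (tks w wks)).
by apply: contraNneq jks => ->; apply/mapP; exists w.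
Qed.

(** The case of a single label, whose only fibre has [n] elements. *)
Lemma card_perm_prescribed (n : nat) (ks : seq ('I_n * 'I_n)) : uniq (unzip1 ks) ->
  (#|[set s : 'S_n | all (fun z => s z.1 == z.2) ks]| * n ^_ (size ks) <= n`!)%N.
Proof.
move=> uks.
have fib (y : 'I_n) : (n <= #|[set j : 'I_n | tt == tt]|)%N.
  by rewrite (_ : [set _ | _] = [set: 'I_n]) ?cardsT ?card_ord //; apply/setP => j; rewrite !inE.
have G : relabellings (fun _ : 'I_n => tt) (fun=> tt) = [set: 'S_n].
  by apply/setP => t; rewrite !inE; apply/forallP.
have := @card_relabellings_prescribed n n _ (fun=> tt) (fun=> tt) ks fib uks.
rewrite G cardsT card_Sn; congr (_ * _ <= _)%N.
by apply: eq_card => t; rewrite !inE.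
Qed.

(** Double counting: [#|A w| ^_ k] is the number of [k]-tuples of distinct elements of [A w]. The
    predicate [G] records what such tuples must satisfy, which limits the sum after the exchange. *)
Lemma sum_ffact_card (W X : finType) (P : pred W) (A : W -> pred X) (k : nat)
    (G : pred (k.-tuple X)) :
  (forall w (ks : k.-tuple X), P w -> all (A w) ks -> uniq ks -> G ks) ->
  (\sum_(w | P w) #|A w| ^_ k <= \sum_(ks | G ks) #|[set w | P w & all (A w) ks]|)%N.
Proof.
move=> PG.
under eq_bigr do rewrite -card_uniq_tuples.
have e w : P w -> #|[set t : k.-tuple X | all (A w) t & uniq t]| =
    (\sum_(ks | G ks) (all (A w) ks && uniq ks))%N.
  move=> Pw; rewrite -sum1_card big_mkcond [RHS]big_mkcond /=; apply: eq_bigr => ks _.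
  rewrite inE; case/boolP: (all (A w) ks && uniq ks) => [/andP[a u]|_]; last by case: ifP.
  by rewrite (PG w).
rewrite (eq_bigr _ e) exchange_big /=; apply: leq_sum => ks _.
rewrite -sum1_card big_mkcond [X in (_ <= X)%N]big_mkcond /=; apply: leq_sum => w _.
rewrite inE; case: (P w) => //=; case: (all _ _) => //=; exact: leq_b1.
Qed.

(** Factorial moments of the number of points in a rectangle: [k] distinct positions in [I] and [k]
    distinct values in [J] are matched in order by a fraction of at most [1 / n ^_ k] of the
    permutations. *)
Lemma sum_ffact_card_hits (n k : nat) (I J : {set 'I_n}) :
  ((\sum_(s : 'S_n) #|[set i in I | s i \in J]| ^_ k) * n ^_ k <= n`! * (#|I| ^_ k * #|J| ^_ k))%N.
Proof.
pose A (s : 'S_n) : pred ('I_n * 'I_n) := [pred z | [&& z.1 \in I, z.2 \in J & s z.1 == z.2]].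
have cA (s : 'S_n) : #|[set i in I | s i \in J]| = #|A s|.
  have inj : injective (fun i : 'I_n => (i, s i)) by move=> i j [].
  rewrite -(card_imset _ inj); apply: eq_card => -[i j]; rewrite !inE /=.
  apply/imsetP/and3P => [[x]|[iI jJ /eqP e]].
    by rewrite inE => /andP[xI xJ] [-> ->].
  by exists i; rewrite ?inE ?e ?iI.
under eq_bigr do rewrite cA.
pose G := [pred ks : k.-tuple ('I_n * 'I_n) | [&& uniq (unzip1 ks), uniq (unzip2 ks),
  all (mem I) (unzip1 ks) & all (mem J) (unzip2 ks)]].
have sG (s : 'S_n) (ks : k.-tuple _) : true -> all (A s) ks -> uniq ks -> G ks.
  move=> _ /allP aA u.
  have e (z : 'I_n * 'I_n) : z \in ks -> s z.1 = z.2 by move=> /aA /and3P[_ _ /eqP].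
  apply/and4P; split.
  - rewrite map_inj_in_uniq // => -[a b] [c d] /e /= <- /e /= <- /= ->; by [].
  - rewrite map_inj_in_uniq // => -[a b] [c d] /e /= <- /e /= <- /= /perm_inj ->; by [].
  - by apply/allP => _ /mapP[z /aA /and3P[zI _ _] ->].
  - by apply/allP => _ /mapP[z /aA /and3P[_ zI _] ->].
apply: (leq_trans (leq_mul (sum_ffact_card sG) (leqnn _))).
rewrite big_distrl /=.
apply: (@leq_trans (\sum_(ks | G ks) n`!)%N).
  apply: leq_sum => ks /and4P[u1 _ _ _].
  apply: leq_trans (card_perm_prescribed u1); rewrite size_tuple leq_mul2r; apply/orP; right.
  apply: subset_leq_card; apply/fintype.subsetP => s; rewrite !inE /= => /allP h.
  by apply/allP => z /h /and3P[].
rewrite sum_nat_const mulnC leq_mul2l; apply/orP; right.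
rewrite -[X in (_ <= X * _)%N](card_uniq_tuples k (mem I)).
rewrite -(card_uniq_tuples k (mem J)) -cardsX.
have inj : injective (fun ks : k.-tuple ('I_n * 'I_n) => ([tuple of unzip1 ks], [tuple of unzip2 ks])).
  move=> a b [e1 e2]; apply: val_inj => /=.
  by rewrite -(zip_unzip a) -(zip_unzip b) e1 e2.
rewrite -(card_imset _ inj); apply: subset_leq_card.
by apply/fintype.subsetP => _ /imsetP[ks + ->]; rewrite !inE /= => /and4P[-> -> -> ->].
Qed.

(* A quadruple [((x, v), (y, u))] pairs the point [(x, v)] of one permutation with the point
   [(y, u)] of another one. *)
Local Notation pairing n := (('I_n * 'I_n) * ('I_n * 'I_n))%type.

Definition paired (n : nat) (s p tau : 'S_n) (z : pairing n) : bool :=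
  [&& s z.1.1 == z.1.2, p z.2.1 == z.2.2 & tau z.1.1 == z.2.1].

(** The necessary condition, independent of [tau], for [tau] to pair all the points of [ks] when
    these are distinct. *)
Definition realised (n t : nat) (s p : 'S_n) (ks : t.-tuple (pairing n)) : bool :=
  [&& uniq [seq z.1.1 | z <- ks], uniq [seq z.2.1 | z <- ks] &
      all (fun z => (s z.1.1 == z.1.2) && (p z.2.1 == z.2.2)) ks].

(** A realised tuple prescribes [t] values of [tau], which a fraction of at most [1 / m ^_ t] of the
    relabellings satisfy. *)
Lemma sum_ffact_card_paired (n m t : nat) (K : eqType) (f g : 'I_n -> K) (s p : 'S_n)
    (Q : {set pairing n}) :
  (forall y, (m <= #|[set j | g j == g y]|)%N) ->
  ((\sum_(tau in relabellings f g) #|[set z in Q | paired s p tau z]| ^_ t) * m ^_ t <=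
   #|relabellings f g| *
   #|[set ks : t.-tuple (pairing n) | all (mem Q) ks && realised s p ks]|)%N.
Proof.
move=> fib.
pose G := [pred ks : t.-tuple (pairing n) | all (mem Q) ks && realised s p ks].
have sG (tau : 'S_n) (ks : t.-tuple (pairing n)) :
    tau \in relabellings f g -> all (mem [set z in Q | paired s p tau z]) ks -> uniq ks -> G ks.
  move=> _ /allP a u.
  have a' z : z \in ks -> [/\ z \in Q, s z.1.1 = z.1.2, p z.2.1 = z.2.2 & tau z.1.1 = z.2.1].
    by move=> /a; rewrite !inE => /and4P[-> /eqP -> /eqP -> /eqP ->].
  have inj1 : {in ks &, injective (fun z : pairing n => z.1.1)}.
    move=> [[x v] [y w]] [[x' v'] [y' w']] /a' /= [_ <- <- <-] /a' /= [_ <- <- <-] -> //.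
  apply/and4P; split.
  - by apply/allP => z /a' [].
  - by rewrite map_inj_in_uniq.
  - rewrite map_inj_in_uniq // => z z' zk zk'.
    have [_ _ _ <-] := a' _ zk; have [_ _ _ <-] := a' _ zk'.
    by move=> /perm_inj; exact: inj1.
  - by apply/allP => z /a' [_ -> -> _]; rewrite !eqxx.
apply: (leq_trans (leq_mul (sum_ffact_card sG) (leqnn _))).
rewrite big_distrl /= mulnC.
rewrite (_ : #|[set ks | _]| = #|G|); last by apply: eq_card => ks; rewrite !inE.
rewrite -sum_nat_const; apply: leq_sum => ks /and4P[_ u1 _ _].
pose ks' := [seq (z.1.1, z.2.1) | z <- ks].
have := @card_relabellings_prescribed n m _ f g ks' fib.
rewrite /unzip1 -map_comp size_map size_tuple => /(_ u1); apply: leq_trans.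
rewrite leq_mul2r; apply/orP; right; apply: subset_leq_card; apply/fintype.subsetP => tau.
rewrite !inE => /andP[-> /allP a]; rewrite all_map; apply/allP => z /a /=.
by rewrite !inE => /and4P[].
Qed.

(** A tuple with distinct positions prescribes [t] values of [s] and [t] values of [p], hence the
    square of [n ^_ t]; there are [#|Q| ^ t] tuples in all. *)
Lemma sum_card_realised (n t : nat) (Q : {set pairing n}) :
  ((\sum_(sp : 'S_n * 'S_n)
     #|[set ks : t.-tuple (pairing n) | all (mem Q) ks && realised sp.1 sp.2 ks]|)
    * (n ^_ t) ^ 2 <= #|Q| ^ t * n`! ^ 2)%N.
Proof.
have -> : (\sum_(sp : 'S_n * 'S_n) #|[set ks : t.-tuple (pairing n) |
       all (mem Q) ks && realised sp.1 sp.2 ks]| =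
    \sum_(ks : t.-tuple (pairing n) | all (mem Q) ks)
       #|[set sp : 'S_n * 'S_n | realised sp.1 sp.2 ks]|)%N.
  under eq_bigr do rewrite -sum1_card big_mkcond /=.
  rewrite exchange_big [RHS]big_mkcond /=; apply: eq_bigr => ks _.
  case: ifP => aQ; last by rewrite big1 // => sp _; rewrite inE aQ.
  by rewrite -sum1_card [RHS]big_mkcond /=; apply: eq_bigr => sp _; rewrite !inE aQ.
rewrite big_distrl /=.
apply: (@leq_trans (\sum_(ks : t.-tuple (pairing n) | all (mem Q) ks) n`! ^ 2)%N).
  apply: leq_sum => ks _.
  case/boolP: (uniq [seq z.1.1 | z <- ks] && uniq [seq z.2.1 | z <- ks]); last first.
    move=> nu; rewrite (_ : [set _ | _] = finset.set0) ?cards0 //.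
    by apply/setP => sp; rewrite !inE /realised andbA (negbTE nu).
  move=> /andP[u1 u2].
  pose k1 := [seq z.1 | z <- ks]; pose k2 := [seq z.2 | z <- ks].
  have uk1 : uniq (unzip1 k1) by rewrite /unzip1 -map_comp.
  have uk2 : uniq (unzip1 k2) by rewrite /unzip1 -map_comp.
  have := leq_mul (card_perm_prescribed uk1) (card_perm_prescribed uk2).
  rewrite !size_map !size_tuple mulnACA -!mulnn; apply: leq_trans.
  rewrite leq_mul2r -cardsX; apply/orP; right; apply: subset_leq_card.
  apply/fintype.subsetP => -[s p]; rewrite !inE /= => /and3P[_ _ /allP a].
  by rewrite !all_map; apply/andP; split; apply/allP => z /a /andP[].
rewrite sum_nat_const leq_mul2r; apply/orP; right.
pose F (ks : t.-tuple (pairing n)) := [ffun i => tnth ks i].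
have injF : injective F.
  by move=> a b /ffunP e; apply: eq_from_tnth => i; have := e i; rewrite !ffunE.
have := card_ffun_on 'I_t (mem Q); rewrite card_ord => <-.
rewrite -(fintype.card_image injF); apply: subset_leq_card.
apply/fintype.subsetP => _ /fintype.imageP[ks /= aQ ->]; apply/ffun_onP => i; rewrite ffunE.
by apply: (allP aQ); exact: mem_tnth.
Qed.

Lemma leq_ffactl (m n k : nat) : (m <= n)%N -> (m ^_ k <= n ^_ k)%N.
Proof.
elim: k m n => [|k IH] m n mn; first by rewrite !ffactn0.
by rewrite !ffactnS leq_mul // IH // -!subn1 leq_sub2r.
Qed.

(* If every relabelling meets some overcrowded window, averaging over the relabellings bounds the
   number of realised [t]-tuples from below; that number is small on average over [(s, p)]. *)
Lemma card_overcrowded (n m t c q : nat) (K : eqType) (lab : 'S_n -> 'I_n -> K) (V : finType)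
    (Q : V -> {set pairing n}) (D : {set 'S_n}) :
  (forall s y, s \in D -> (m <= #|[set j | lab s j == lab s y]|)%N) ->
  (forall s p, s \in D -> p \in D -> (0 < #|relabellings (lab s) (lab p)|)%N) ->
  (forall w, (#|Q w| <= q)%N) ->
  (#|[set sp : 'S_n * 'S_n | [&& sp.1 \in D, sp.2 \in D &
       [forall tau in relabellings (lab sp.1) (lab sp.2),
         [exists w, (c <= #|[set z in Q w | paired sp.1 sp.2 tau z]|)%N]]]]|
    * (c ^_ t * m ^_ t * (n ^_ t) ^ 2) <= #|V| * q ^ t * n`! ^ 2)%N.
Proof.
move=> fib G0 Qq.
set Bad := [set sp | _].
pose M w (sp : 'S_n * 'S_n) :=
  #|[set ks : t.-tuple (pairing n) | all (mem (Q w)) ks && realised sp.1 sp.2 ks]|.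
have key sp : sp \in Bad -> (c ^_ t * m ^_ t <= \sum_w M w sp)%N.
  case: sp => s p; rewrite inE /= => /and3P[sD pD /forall_inP bad].
  rewrite -(leq_pmul2l (G0 s p sD pD)).
  apply: (@leq_trans ((\sum_w \sum_(tau in relabellings (lab s) (lab p))
      #|[set z in Q w | paired s p tau z]| ^_ t) * m ^_ t)%N).
    rewrite mulnA leq_mul2r; apply/orP; right.
    rewrite exchange_big /= -sum_nat_const; apply: leq_sum => tau /bad /existsP[w cw].
    rewrite (bigD1 w) //=; apply: leq_trans (leq_addr _ _).
    exact: leq_ffactl.
  rewrite big_distrl /= big_distrr /=; apply: leq_sum => w _.
  by apply: sum_ffact_card_paired => y; exact: fib.
rewrite mulnA.
apply: (@leq_trans ((\sum_w \sum_sp M w sp) * (n ^_ t) ^ 2)%N).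
  rewrite leq_mul2r exchange_big /=; apply/orP; right.
  rewrite -sum_nat_const big_mkcond /=; apply: leq_sum => sp _.
  by case: ifP => // /key.
rewrite big_distrl /= -mulnA -sum_nat_const; apply: leq_sum => w _.
apply: (leq_trans (sum_card_realised t (Q w))); rewrite leq_mul2r; apply/orP; right.
case: (t) => [|t'] //.
by rewrite leq_exp2r.
Qed.

(** * Exponential moments and Chernoff bounds *)

(** The range of summation does not depend on [N], so that it can be exchanged with a sum over
    permutations. *)
Lemma exprD1n_bound (R : comPzRingType) (x : R) (N a : nat) : (N <= a)%N ->
  (1 + x) ^+ N = \sum_(k < a.+1) x ^+ k *+ 'C(N, k).
Proof.
move=> Na; rewrite addrC exprD1n (big_ord_widen a.+1 (fun k => x ^+ k *+ 'C(N, k))) ?ltnS //.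
rewrite big_mkcond /=; apply: eq_bigr => k _; case: ifPn => //.
by rewrite -leqNgt => Nk; rewrite bin_small ?mulr0n.
Qed.

Lemma ffact_mul_exp (b n k : nat) : (b <= n)%N -> (b ^_ k * n ^ k <= b ^ k * n ^_ k)%N.
Proof.
move=> bn; elim: k => // k IH; rewrite !ffactnSr !expnSr.
rewrite [X in (X <= _)%N]mulnACA [X in (_ <= X)%N]mulnACA; apply: leq_mul => //.
by rewrite mulnBl mulnBr leq_sub2l // mulnC leq_mul2l bn orbT.
Qed.

(** The right side is the generating function of a binomial variable with [#|I|] trials of success
    probability [#|J| / n]. Factorial moments without replacement are at most those with
    replacement, and [x] is nonnegative, so the comparison holds term by term. *)
Lemma expectation_exp_hits (R : realFieldType) (n : nat) (I J : {set 'I_n}) (x : R) : 0 <= x ->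
  \sum_(s : 'S_n) (1 + x) ^+ #|[set i in I | s i \in J]| <=
    n`!%:R * (1 + x * (#|J|%:R / n%:R)) ^+ #|I|.
Proof.
move=> x0; set a := #|I|; set b := #|J|.
have an : (a <= n)%N by rewrite -[X in (_ <= X)%N]card_ord max_card.
have bn : (b <= n)%N by rewrite -[X in (_ <= X)%N]card_ord max_card.
have Na (s : 'S_n) : (#|[set i in I | s i \in J]| <= a)%N.
  by apply: subset_leq_card; apply/fintype.subsetP => i; rewrite inE => /andP[].
under eq_bigr do rewrite (exprD1n_bound x (Na _)).
rewrite exchange_big /= (exprD1n_bound _ (leqnn a)) big_distrr /=.
apply: ler_sum => k _; under eq_bigr do rewrite -mulr_natr.
rewrite -big_distrr /= exprMn -mulrnAr mulrCA; apply: ler_wpM2l; first exact: exprn_ge0.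
have kn : (k <= n)%N by apply: leq_trans an; rewrite -ltnS.
have kf : (0 < k`!)%N by exact: fact_gt0.
rewrite -(@ler_pM2r _ k`!%:R) ?ltr0n // big_distrl /=.
under eq_bigr do rewrite -natrM bin_ffact.
rewrite -natr_sum.
have -> : n`!%:R * ((b%:R / n%:R) ^+ k *+ 'C(a, k)) * k`!%:R =
    n`!%:R * (a ^_ k)%:R * (b ^ k)%:R / (n ^ k)%:R :> R.
  by rewrite -mulr_natr -bin_ffact natrM expr_div_n !natrX; ring.
(* If [n] is [0], then so is [k], and the power is [1]. *)
have n0 : 0 < (n ^ k)%:R :> R.
  by rewrite ltr0n expn_gt0; case: posnP kn => //= ->; rewrite leqn0 => ->.
have nf : 0 < (n ^_ k)%:R :> R by rewrite ltr0n ffact_gt0.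
rewrite ler_pdivlMr //.
rewrite -(ler_pM2r nf) -!natrM ler_nat.
have H := leq_mul (sum_ffact_card_hits k I J) (leqnn (n ^ k)).
rewrite mulnAC; apply: (leq_trans H).
by rewrite -!mulnA !leq_mul2l ffact_mul_exp ?orbT.
Qed.

(** Markov's inequality in counting form. *)
Lemma card_le_sum_weight (R : realFieldType) (T : finType) (P : {set T}) (F : T -> R) (c : R) :
  (forall x, 0 <= F x) -> (forall x, x \in P -> c <= F x) -> #|P|%:R * c <= \sum_x F x.
Proof.
move=> F0 cF; rewrite mulr_natl -sumr_const.
rewrite [X in _ <= X](bigID (mem P)) /= -[X in X <= _]addr0; apply: lerD.
  exact: ler_sum.
exact: sumr_ge0.
Qed.

Lemma expRX_le (R : realType) (x y : R) (N : nat) : 0 <= y -> expR x <= y -> expR (N%:R * x) <= y ^+ N.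
Proof. by move=> y0 xy; rewrite expRM_natl lerXn2r // nnegrE ?expR_ge0. Qed.

Lemma hits_upper_tail (R : realType) (n : nat) (I J : {set 'I_n}) (v d : R) :
  0 < v -> #|I|%:R * #|J|%:R / n%:R <= v -> 0 <= d <= 2 * v ->
  #|[set s : 'S_n | #|I|%:R * #|J|%:R / n%:R + d <= #|[set i in I | s i \in J]|%:R]|%:R
    <= n`!%:R * expR (- (d ^+ 2 / (16 * v))).
Proof.
move=> v0; set mu := _ / n%:R => muv /andP[d0 dv].
(* With this weight, [d <= 2 * v] gives [x <= 1 / 2], and the final exponent is at most
   [- v * x ^+ 2], which is the claimed one. *)
pose x := d / (4 * v).
have x0 : 0 <= x by apply: divr_ge0 => //; lra.
have x1 : x <= 1 / 2 by rewrite ler_pdivrMr; lra.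
have dx : d = 4 * v * x by rewrite /x; field; lra.
have mu0 : 0 <= mu by rewrite divr_ge0 // mulr_ge0.
(* Multiply by [expR (- (x - x ^+ 2)) >= 1 - x + x ^+ 2] and use
   [(1 + x) * (1 - x + x ^+ 2) = 1 + x ^+ 3]. *)
have ex : expR (x - x ^+ 2) <= 1 + x.
  rewrite -(ler_pM2r (expR_gt0 (- (x - x ^+ 2)))) -expRD subrr expR0.
  apply: (@le_trans _ _ ((1 + x) * (1 - (x - x ^+ 2)))); first nra.
  by apply: ler_wpM2l; [lra | exact: expR_ge1Dx].
have xx0 : 0 <= x - x ^+ 2 by nra.
have H := @card_le_sum_weight R _ [set s : 'S_n | mu + d <= #|[set i in I | s i \in J]|%:R]
  (fun s => (1 + x) ^+ #|[set i in I | s i \in J]|) (expR ((mu + d) * (x - x ^+ 2))).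
have {}H := le_trans (H _ _) (expectation_exp_hits I J x0).
rewrite -(ler_pM2r (expR_gt0 ((mu + d) * (x - x ^+ 2)))).
apply: le_trans (H _ _) _.
- by move=> s; apply: exprn_ge0; lra.
- move=> s; rewrite inE => Ns; apply: le_trans (expRX_le _ _ ex); last lra.
  by rewrite ler_expR ler_wpM2r.
- rewrite -[X in _ <= X]mulrA -expRD; apply: ler_wpM2l => //.
  apply: (@le_trans _ _ (expR (x * mu))).
    rewrite (_ : x * mu = #|I|%:R * (x * (#|J|%:R / n%:R))); last by rewrite /mu; ring.
    by rewrite expRM_natl lerXn2r ?nnegrE ?expR_ge0 ?expR_ge1Dx // addr_ge0 // mulr_ge0 // divr_ge0.
  rewrite ler_expR (_ : d ^+ 2 / (16 * v) = v * x ^+ 2); last by rewrite dx; field; lra.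
  rewrite dx; nra.
Qed.

(** The weight is now [1 - y < 1] per hit. Counting misses, that is hits of [~: J], turns it into a
    weight [1 + x = (1 - y)^-1] above [1], to which the moment bound applies. *)
Lemma hits_lower_tail (R : realType) (n : nat) (I J : {set 'I_n}) (v d : R) :
  0 < v -> #|I|%:R * #|J|%:R / n%:R <= v -> 0 <= d <= 2 * v ->
  #|[set s : 'S_n | #|[set i in I | s i \in J]|%:R <= #|I|%:R * #|J|%:R / n%:R - d]|%:R
    <= n`!%:R * expR (- (d ^+ 2 / (16 * v))).
Proof.
move=> v0; set mu := _ / n%:R => muv /andP[d0 dv].
(* Division by zero gives mean [0] here: the bound is trivial for [d = 0], and the set is empty for
   [d > 0]. *)
have [n0|n0] := posnP n.
  have nR : n%:R = 0 :> R by rewrite n0.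
  have mu0 : mu = 0 by rewrite /mu nR invr0 mulr0.
  case: (eqVneq d 0) => [->|dn0].
    rewrite expr0n mul0r oppr0 expR0 mulr1 ler_nat -card_Sn.
    exact: max_card.
  rewrite (_ : [set s | _] = finset.set0) ?cards0 ?mulr_ge0 ?expR_ge0 //.
  apply/setP => s; rewrite !inE; apply/negbTE; rewrite -ltNge mu0.
  by apply: (@lt_le_trans _ _ 0) => //; rewrite sub0r oppr_lt0 lt_def dn0.
pose y := d / (4 * v).
have y0 : 0 <= y by apply: divr_ge0 => //; lra.
have y1 : y <= 1 / 2 by rewrite ler_pdivrMr; lra.
have dy : d = 4 * v * y by rewrite /y; field; lra.
have mu0 : 0 <= mu by rewrite divr_ge0 // mulr_ge0.
have ey : expR (- (y + 2 * y ^+ 2)) <= 1 - y.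
  rewrite expRN invf_ple ?posrE ?expR_gt0 //; last lra.
  apply: le_trans (expR_ge1Dx _).
  by rewrite -[X in X <= _]mul1r ler_pdivrMr; nra.
have yy0 : 0 <= y + 2 * y ^+ 2 by nra.
have sub (s : 'S_n) : #|[set i in I | s i \in J]| = (#|I| - #|[set i in I | s i \in ~: J]|)%N.
  rewrite -(cardsID [set i | s i \in J] I) (_ : I :&: _ = [set i in I | s i \in J]).
    by rewrite (_ : I :\: _ = [set i in I | s i \in ~: J]) ?addnK //; apply/setP => i; rewrite !inE andbC.
  by apply/setP => i; rewrite !inE.
have lC (s : 'S_n) : (#|[set i in I | s i \in ~: J]| <= #|I|)%N.
  by apply: subset_leq_card; apply/fintype.subsetP => i; rewrite inE => /andP[].
have y1' : 1 - y != 0 by apply/eqP; lra.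
have E : \sum_(s : 'S_n) (1 - y) ^+ #|[set i in I | s i \in J]| <= n`!%:R * expR (- (y * mu)).
  pose x := y / (1 - y).
  have xE : 1 + x = (1 - y)^-1 by rewrite /x; field.
  have x0 : 0 <= x by apply: divr_ge0; lra.
  have -> : \sum_(s : 'S_n) (1 - y) ^+ #|[set i in I | s i \in J]| =
     (1 - y) ^+ #|I| * \sum_(s : 'S_n) (1 + x) ^+ #|[set i in I | s i \in ~: J]|.
    rewrite big_distrr /=; apply: eq_bigr => s _; rewrite sub xE exprB ?exprVn // unitfE //.
  apply: le_trans (ler_wpM2l _ (expectation_exp_hits I (~: J) x0)) _.
    by apply: exprn_ge0; lra.
  rewrite mulrCA -exprMn; apply: ler_wpM2l => //.
  have nR : n%:R != 0 :> R by rewrite pnatr_eq0 -lt0n.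
  have bn : (#|J| <= n)%N by rewrite -[X in (_ <= X)%N]card_ord max_card.
  have -> : (1 - y) * (1 + x * (#|~: J|%:R / n%:R)) = 1 + - (y * (#|J|%:R / n%:R)).
    by rewrite cardsCs finset.setCK card_ord natrB // /x; field; rewrite nR.
  rewrite (_ : - (y * mu) = #|I|%:R * - (y * (#|J|%:R / n%:R))); last by rewrite /mu; ring.
  rewrite expRM_natl lerXn2r ?nnegrE ?expR_ge0 ?expR_ge1Dx //.
  have : #|J|%:R / n%:R <= 1 :> R by rewrite ler_pdivrMr ?ltr0n // mul1r ler_nat.
  have : 0 <= #|J|%:R / n%:R :> R by rewrite divr_ge0.
  nra.
have H := @card_le_sum_weight R _ [set s : 'S_n | #|[set i in I | s i \in J]|%:R <= mu - d]
  (fun s => (1 - y) ^+ #|[set i in I | s i \in J]|) (expR (- ((mu - d) * (y + 2 * y ^+ 2)))).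
have {}H := le_trans (H _ _) E.
rewrite -(ler_pM2r (expR_gt0 (- ((mu - d) * (y + 2 * y ^+ 2))))).
apply: le_trans (H _ _) _.
- by move=> s; apply: exprn_ge0; lra.
- move=> s; rewrite inE => Ns; apply: le_trans (expRX_le _ _ ey); last lra.
  by rewrite ler_expR mulrN lerN2 ler_wpM2r.
- rewrite -[X in _ <= X]mulrA -expRD; apply: ler_wpM2l => //; rewrite ler_expR.
  rewrite (_ : d ^+ 2 / (16 * v) = v * y ^+ 2); last by rewrite dy; field; lra.
  rewrite dy; nra.
Qed.

(** * Even spread over all rectangles *)

Definition itv (n l r : nat) : {set 'I_n} := [set i : 'I_n | (l <= i < r)%N].

Lemma card_itv (n l r : nat) : (r <= n)%N -> #|itv n l r| = (r - l)%N.
Proof.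
move=> rn.
have e : (l + (r - l) <= n)%N || (r <= l)%N by lia.
case/orP: e => [e|e]; last first.
  rewrite (_ : itv n l r = finset.set0) ?cards0; first lia.
  by apply/setP => i; rewrite !inE; lia.
have inj : injective (fun j : 'I_(r - l) => widen_ord e (rshift l j)).
  by move=> i j /(congr1 val) /= /addnI /val_inj.
rewrite -[RHS]card_ord -(card_imset _ inj); apply: eq_card => i; rewrite inE.
apply/idP/imsetP => [h|[j _ ->]] /=; last by have := ltn_ord j; lia.
have h' : (i - l < r - l)%N by lia.
by exists (Ordinal h') => //; apply: val_inj => /=; lia.
Qed.

(** Directions are Booleans, [false] for positions and [true] for values, so that one argument
    serves for both kinds of halving. *)
Definition pcoord (n : nat) (s : 'S_n) (b : bool) (i : 'I_n) : nat := if b then s i else i.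

Lemma pcoord_inj (n : nat) (s : 'S_n) (b : bool) : injective (pcoord s b).
Proof. by case: b => i j /val_inj //; exact: perm_inj. Qed.

Lemma pcoord_lt (n : nat) (s : 'S_n) (b : bool) (i : 'I_n) : (pcoord s b i < n)%N.
Proof. by case: b => /=; exact: ltn_ord. Qed.

Definition cell (n : nat) (s : 'S_n) (lo hi : bool -> nat) : {set 'I_n} :=
  [set i | [forall b, (lo b <= pcoord s b i < hi b)%N]].

Definition area (R : realType) (lo hi : bool -> nat) : R :=
  (hi false - lo false)%:R * (hi true - lo true)%:R.

(* The restriction [64 * L <= v] keeps the deviation [16 * sqrt (L * v)] below [2 * v], the range
   where the tail bound is Gaussian; it is then exceeded with probability at most [2 e^{-16 L}]. *)
Definition evenly_spread (R : realType) (L : R) (n : nat) (s : 'S_n) : Prop :=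
  forall lo hi : bool -> nat, (forall b, (lo b <= hi b <= n)%N) ->
  forall v, 64 * L <= v -> area R lo hi / n%:R <= v ->
  `|#|cell s lo hi|%:R - area R lo hi / n%:R| <= 16 * Num.sqrt (L * v).

Lemma cellE (n : nat) (s : 'S_n) (lo hi : bool -> nat) :
  cell s lo hi = [set i in itv n (lo false) (hi false) | s i \in itv n (lo true) (hi true)].
Proof.
apply/setP => i; rewrite !inE; apply/forallP/andP => [h|[h1 h2] [] //].
by split; [exact: (h false)|exact: (h true)].
Qed.

Lemma hits_deviation (R : realType) (n : nat) (I J : {set 'I_n}) (L mu : R) :
  0 < L -> mu = #|I|%:R * #|J|%:R / n%:R ->
  #|[set s : 'S_n | 16 * Num.sqrt (L * Num.max mu (64 * L)) <= `|#|[set i in I | s i \in J]|%:R - mu|]|%:R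
    <= 2 * n`!%:R * expR (- (16 * L)).
Proof.
move=> L0 muE; set v := Num.max _ _; set d := 16 * _.
have v64 : 64 * L <= v by rewrite le_max lexx orbT.
have v0 : 0 < v by apply: lt_le_trans v64; lra.
have muv : mu <= v by rewrite le_max lexx.
have s2 : Num.sqrt (L * v) ^+ 2 = L * v by rewrite sqr_sqrtr // mulr_ge0 // ltW.
have s0 : 0 <= Num.sqrt (L * v) by exact: sqrtr_ge0.
have dv : 0 <= d <= 2 * v.
  apply/andP; split; first by rewrite /d; lra.
  rewrite -ler_sqr ?nnegrE /d; [|lra|lra].
  rewrite exprMn s2; nra.
have dE : d ^+ 2 / (16 * v) = 16 * L by rewrite /d exprMn s2; field; lra.
rewrite muE in muv.
have U := hits_upper_tail v0 muv dv; have W := hits_lower_tail v0 muv dv.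
rewrite dE -muE in U W.
rewrite (_ : 2 * n`!%:R * _ = n`!%:R * expR (- (16 * L)) + n`!%:R * expR (- (16 * L))); last by ring.
apply: le_trans (lerD U W); rewrite -natrD ler_nat.
apply: (@leq_trans #|[set s : 'S_n | mu + d <= #|[set i in I | s i \in J]|%:R] :|:
   [set s : 'S_n | #|[set i in I | s i \in J]|%:R <= mu - d]|); last by rewrite cardsU leq_subr.
apply: subset_leq_card; apply/fintype.subsetP => s; rewrite !inE.
by case: (lerP 0 (#|[set i in I | s i \in J]|%:R - mu)) => h; [rewrite ger0_norm|rewrite ltr0_norm] => // ?;
  apply/orP; [left|right]; lra.
Qed.

(** Union bound over the [n.+1 ^ 4] choices of endpoints. The allowed deviation grows with [v], so
    the least admissible [v], the maximum of the mean and [64 * L], suffices. *)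
Lemma card_not_evenly_spread (R : realType) (L : R) (n : nat) : 0 < L ->
  #|[set s : 'S_n | ~~ `[< evenly_spread L s >]]|%:R <= (n.+1 ^ 4)%:R * (2 * n`!%:R * expR (- (16 * L))).
Proof.
move=> L0.
pose X := ('I_n.+1 * 'I_n.+1 * ('I_n.+1 * 'I_n.+1))%type.
pose I (x : X) := itv n x.1.1 x.1.2; pose J (x : X) := itv n x.2.1 x.2.2.
pose mu (x : X) : R := #|I x|%:R * #|J x|%:R / n%:R.
pose B (x : X) := [set s : 'S_n | 16 * Num.sqrt (L * Num.max (mu x) (64 * L)) <=
   `|#|[set i in I x | s i \in J x]|%:R - mu x|].
apply: (@le_trans _ _ (\sum_x #|B x|%:R)).
  rewrite -natr_sum ler_nat.
  apply: (@leq_trans #|\bigcup_x B x|); last first.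
    elim/big_rec2: _ => [|x m A _ mA]; first by rewrite cards0.
    apply: leq_trans (leq_add (leqnn _) mA); exact: leq_card_setU.
  apply: subset_leq_card; apply/fintype.subsetP => s; rewrite inE => /asboolPn; apply: contra_notT.
  move=> nB lo hi lohi v v64 av.
  have lo1 b : (lo b < n.+1)%N by have /andP[] := lohi b; lia.
  have hi1 b : (hi b < n.+1)%N by have /andP[] := lohi b; lia.
  pose x : X := ((Ordinal (lo1 false), Ordinal (hi1 false)), (Ordinal (lo1 true), Ordinal (hi1 true))).
  have mE : mu x = area R lo hi / n%:R.
    by rewrite /mu /area !card_itv //=; [have /andP[] := lohi true|have /andP[] := lohi false].
  have : s \notin B x by apply: contra nB => sB; apply/finset.bigcupP; exists x.
  rewrite inE -ltNge => /ltW; rewrite cellE mE => H; apply: le_trans H _.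
  rewrite ler_pM2l //; apply: ler_wsqrtr; rewrite ler_pM2l //.
  by rewrite ge_max av v64.
apply: (@le_trans _ _ (\sum_(x : X) 2 * n`!%:R * expR (- (16 * L)))).
  by apply: ler_sum => x _; exact: hits_deviation.
by rewrite sumr_const -[X in X <= _]mulr_natl !card_prod card_ord (_ : _ * _ = n.+1 ^ 4)%N //; lia.
Qed.

(** * The halving tree *)

Lemma discrete_ivt (g : nat -> nat) (a b h : nat) : (a <= b)%N -> (g a <= h <= g b)%N ->
  (forall c, (g c.+1 <= (g c).+1)%N) -> exists2 c, (a <= c <= b)%N & g c = h.
Proof.
move=> ab gh g1; rewrite -(subnKC ab) in gh *; move: (b - a)%N gh => k {ab b}.
elim: k => [|k IH] => [|/andP[ga gb]].
  by rewrite addn0 -eqn_leq => /eqP ga; exists a => //; rewrite leqnn.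
have [gk|gk] := leqP h (g (a + k)%N).
  by have [|c hc <-] := IH; [rewrite ga gk|exists c => //; lia].
exists (a + k.+1)%N; first lia.
by apply/eqP; rewrite eqn_leq gb addnS (leq_trans (g1 _)).
Qed.

Definition upd (f : bool -> nat) (d : bool) (c : nat) (b : bool) : nat := if b == d then c else f b.

(** Coordinates are injective, so moving the cut by one adds at most one point and every
    intermediate count occurs. *)
Lemma cell_cut (n : nat) (s : 'S_n) (lo hi : bool -> nat) (d : bool) (h : nat) :
  (lo d <= hi d)%N -> (h <= #|cell s lo hi|)%N ->
  exists2 c, (lo d <= c <= hi d)%N & #|cell s lo (upd hi d c)| = h.
Proof.
move=> lohi hM; apply: (discrete_ivt (g := fun c => #|cell s lo (upd hi d c)|)) => //.
  have -> : cell s lo (upd hi d (lo d)) = finset.set0.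
    by apply/setP => i; rewrite !inE; apply/negbTE/forallP => /(_ d); rewrite /upd eqxx; lia.
  rewrite cards0; apply: leq_trans hM _; apply: subset_leq_card; apply/fintype.subsetP => i.
  by rewrite !inE => /forallP a; apply/forallP => b; have := a b; rewrite /upd; case: eqP => // ->.
move=> c; have [/fintype.existsP[i0 /eqP ic]|nc] := boolP [exists i, pcoord s d i == c]; last first.
  apply: (@leq_trans #|cell s lo (upd hi d c)|) => //; apply: subset_leq_card.
  apply/fintype.subsetP => i; rewrite !inE => /forallP a; apply/forallP => b.
  have := a b; rewrite /upd; case: eqP => // ->.
  by move/fintype.existsPn/(_ i): nc; lia.
rewrite -[X in (_ <= X)%N]add1n.
apply: (@leq_trans #|i0 |: cell s lo (upd hi d c)|); last first.
  by rewrite cardsU1 leq_add2r leq_b1.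
apply: subset_leq_card; apply/fintype.subsetP => i; rewrite !inE => /forallP a.
case: eqVneq => //= ni; apply/forallP => b.
have := a b; rewrite /upd; case: eqP => // ->.
have : pcoord s d i != c by rewrite -ic (inj_eq (@pcoord_inj _ s d)).
by lia.
Qed.

(* A cell is labelled by the list of its halvings, the most recent one first; [true] stands for the
   upper half. Positions are halved at even depths and values at odd depths. *)
Fixpoint leaf_size (n : nat) (c : seq bool) : nat :=
  if c is e :: c' then if e then uphalf (leaf_size n c') else (leaf_size n c')./2 else n.

(** The ideal cell, cut exactly at midpoints, with which the actual cells are compared. *)
Fixpoint box (R : realType) (n : nat) (c : seq bool) (b : bool) : R * R :=
  if c is e :: c' then
    let I := box R n c' b in
    if b == odd (size c') then
      if e then ((I.1 + I.2) / 2, I.2) else (I.1, (I.1 + I.2) / 2)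
    else I
  else (0, n%:R).

Lemma box_width (R : realType) (n : nat) (c : seq bool) (b : bool) :
  (box R n c b).2 - (box R n c b).1 =
  n%:R / 2 ^+ (if b then (size c)./2 else uphalf (size c)).
Proof.
elim: c => [|e c IH]; first by case: b => /=; rewrite expr0; field.
pose k m : nat := if b then m./2 else uphalf m; rewrite -[if b then _ else _]/(k (size c)) in IH.
rewrite -[if b then _ else _]/(k (size c).+1) /=.
case: eqVneq => [bd|bd].
  have -> : k (size c).+1 = (k (size c)).+1 by rewrite /k bd; case: ifP; lia.
  by rewrite exprS invfM mulrCA -IH; case: e => /=; field.
have -> : k (size c).+1 = k (size c) by rewrite /k; case: b bd {IH k}; lia.
exact: IH.
Qed.

(** Each halving halves the error and adds at most [1 / 2] by rounding, so the error never exceeds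
    [1]. *)
Lemma leaf_size_near (R : realType) (n : nat) (c : seq bool) :
  `|(leaf_size n c)%:R - n%:R / 2 ^+ (size c) : R| <= 1.
Proof.
elim: c => [|e c IH]; first by rewrite /= expr0 divr1 subrr normr0.
rewrite [size _]/= exprS invfM mulrCA; move: IH; set x := n%:R / _.
have [] : 2 * (leaf_size n (e :: c))%:R <= (leaf_size n c)%:R + 1 :> R /\
    (leaf_size n c)%:R <= 2 * (leaf_size n (e :: c))%:R + 1 :> R.
  by rewrite -!natrM !natr1 !ler_nat /=; case: e; lia.
move: (leaf_size n (e :: c)) (leaf_size n c) => m z h1 h2.
by rewrite !ler_norml => IH; lra.
Qed.

(* The two counts pin the cut to within [4 D n / w] of the midpoint, where [D] is the deviation
   and [w] the side of the cell in the direction that is not cut. *)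
Lemma midpoint_estimate (R : realFieldType) (n M h X Y Z D w : R) :
  0 < n -> 0 < w -> w / 2 <= Z -> 1 <= D -> `|h - M / 2| <= 1 / 2 ->
  `|h - X * Z / n| <= D -> `|M - Y * Z / n| <= D ->
  `|X - Y / 2| <= 4 * D * n / w.
Proof.
move=> n0 w0 wZ D1 hM hX hY.
have Z0 : 0 < Z by lra.
have E : `|(X - Y / 2) * (Z / n)| <= 2 * D.
  rewrite (_ : _ * _ = X * Z / n - (Y * Z / n) / 2); last by field; lra.
  move: hM hX hY; set a := X * Z / n; set b := Y * Z / n.
  by rewrite !ler_norml => h1 h2 h3; lra.
have Zn : 0 < Z / n by exact: divr_gt0.
rewrite normrM (gtr0_norm Zn) in E.
rewrite -(ler_pM2r Zn); apply: le_trans E _.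
rewrite (_ : _ * (Z / n) = 2 * D * (2 * Z / w)); last by field; lra.
rewrite -[X in X <= _]mulr1 ler_pM2l; last lra.
by rewrite ler_pdivlMr; lra.
Qed.

Definition near_box (R : realType) (n : nat) (delta : R) (c : seq bool) (lo hi : bool -> nat) : Prop :=
  forall b, [/\ (lo b <= hi b <= n)%N, `|(lo b)%:R - (box R n c b).1| <= delta
    & `|(hi b)%:R - (box R n c b).2| <= delta].

Lemma areaE (R : realType) (lo hi : bool -> nat) (d : bool) :
  area R lo hi = (hi d - lo d)%:R * (hi (~~ d) - lo (~~ d))%:R.
Proof. by case: d; rewrite /area //= mulrC. Qed.

Lemma box_sides (R : realType) (n : nat) (c : seq bool) (d : bool) :
  (0 < n)%N -> d = odd (size c) ->
  let w b := (box R n c b).2 - (box R n c b).1 in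
  [/\ forall b, n%:R / 2 ^+ (uphalf (size c)) <= w b,
      n%:R <= w (~~ d) * (2 * 2 ^+ (size c)./2)
    & w d * w (~~ d) <= n%:R * (n%:R / 4 ^+ (size c)./2)].
Proof.
move=> n0 dE w; rewrite /w !box_width.
have nR : 0 < n%:R :> R by rewrite ltr0n.
have p2 k : 0 < 2 ^+ k :> R by rewrite exprn_gt0.
have p2' k : 2 ^+ k != 0 :> R by rewrite gt_eqF.
have mono i j : (i <= j)%N -> n%:R / 2 ^+ j <= n%:R / 2 ^+ i :> R.
  by move=> ij; rewrite ler_pM2l // lef_pV2 ?posrE // ler_weXn2l // ler1n.
set k := (size c)./2.
have e4 : 4 ^+ k = 2 ^+ k * 2 ^+ k :> R by rewrite -exprMn -natrM.
have uE : uphalf (size c) = if d then k.+1 else k by rewrite dE /k; case: ifP; lia.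
split.
- by move=> b; rewrite box_width; apply: mono; case: b; lia.
- rewrite uE; case: (d) => /=; rewrite ?exprS.
    by rewrite divfK // mulf_neq0.
  rewrite mulrCA divfK //; lra.
- rewrite e4 uE; case: (d) => /=; rewrite ?exprS.
    rewrite (_ : _ * (n%:R / (2 * 2 ^+ k)) = n%:R * (n%:R / (2 ^+ k * 2 ^+ k)) / 2); last by field.
    have : 0 <= n%:R * (n%:R / (2 ^+ k * 2 ^+ k)) :> R by rewrite mulr_ge0 // divr_ge0 // mulr_ge0.
    lra.
  by rewrite le_eqVlt; apply/orP; left; apply/eqP; field.
Qed.

(** Rounding follows [leaf_size]: the lower half gets the floor and the upper half the rest. Cell
    sizes thus depend on the label only, not on the permutation. *)
Lemma cell_median (n : nat) (s : 'S_n) (lo hi : bool -> nat) (d : bool) :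
  (forall b, (lo b <= hi b <= n)%N) ->
  exists cut, [/\ (lo d <= cut <= hi d)%N, forall b, (lo b <= upd hi d cut b <= n)%N,
    forall b, (upd lo d cut b <= hi b <= n)%N,
    #|cell s lo (upd hi d cut)| = #|cell s lo hi|./2 &
    #|cell s (upd lo d cut) hi| = uphalf #|cell s lo hi|].
Proof.
move=> lohi.
have hM : (#|cell s lo hi|./2 <= #|cell s lo hi|)%N by lia.
have [|cut cutd cutE] := cell_cut (d := d) _ hM; first by have := lohi d; lia.
exists cut; split => //.
- by move=> b; rewrite /upd; case: eqP => // ->; have := lohi d; lia.
- by move=> b; rewrite /upd; case: eqP => // ->; have := lohi d; lia.
have cutC : (#|cell s lo (upd hi d cut)| + #|cell s (upd lo d cut) hi| = #|cell s lo hi|)%N.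
  rewrite -(cardsID [set i | (pcoord s d i < cut)%N] (cell s lo hi)); congr (_ + _)%N.
    apply: eq_card => i; rewrite !inE; apply/forallP/andP => [a|[/forallP a ic] b].
      split; last by have := a d; rewrite /upd eqxx => /andP[].
      apply/forallP => b; have := a b; rewrite /upd; case: eqP => // -> /andP[-> ic] /=.
      by move/andP: cutd => [_]; exact: leq_trans.
    by have := a b; rewrite /upd; case: eqP => // -> /andP[-> _].
  apply: eq_card => i; rewrite !inE -leqNgt; apply/forallP/andP => [a|[ic /forallP a] b].
    split; first by have := a d; rewrite /upd eqxx => /andP[].
    apply/forallP => b; have := a b; rewrite /upd; case: eqP => // -> /andP[ic ->].
    by move/andP: cutd => [h _]; rewrite (leq_trans h).
  by have := a b; rewrite /upd; case: eqP => // -> /andP[_ ->]; rewrite ic.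
by move: cutE cutC; move: #|_| #|_| #|_| => a b c; lia.
Qed.

(** The counts of the cell and of its lower half are known exactly, so even spread, applied to both,
    forces the cut close to the midpoint of the ideal side. *)
Lemma near_box_split (R : realType) (L delta : R) (n : nat) (s : 'S_n) (c : seq bool)
    (lo hi : bool -> nat) (d : bool) :
  1 <= L -> (0 < n)%N -> evenly_spread L s -> d = odd (size c) ->
  64 * L <= 3 * n%:R / 4 ^+ (size c)./2 ->
  4 * delta <= n%:R / 2 ^+ uphalf (size c) ->
  near_box n delta c lo hi -> #|cell s lo hi| = leaf_size n c ->
  exists cut, forall e,
    let lo' := if e then upd lo d cut else lo in
    let hi' := if e then hi else upd hi d cut in
    near_box n (delta + 256 * Num.sqrt (L * n%:R)) (e :: c) lo' hi' /\
    #|cell s lo' hi'| = leaf_size n (e :: c).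
Proof.
move=> L1 n0 spread dE v64 d4 near cM.
have nR : 0 < n%:R :> R by rewrite ltr0n.
have [wmin wn ww] := box_sides R n0 dE.
set v := 3 * _ / _ in v64; set k := (size c)./2 in v v64 wn ww.
have lohi b : (lo b <= hi b <= n)%N by have [] := near b.
have [cut [/andP[cut1 cut2] upl upr cutE cutE']] := cell_median s d lohi.
pose X : R := (cut - lo d)%:R; pose Y : R := (hi d - lo d)%:R.
pose Z : R := (hi (~~ d) - lo (~~ d))%:R.
pose w b := (box R n c b).2 - (box R n c b).1.
(* Each end is off by at most [delta], hence by at most a quarter of the ideal side. *)
have side b : w b / 2 <= (hi b - lo b)%:R <= 3 / 2 * w b.
  have [/andP[lh _]] := near b; rewrite natrB // /w.
  by have := wmin b; have := d4; rewrite !ler_norml => h1 h2 h3 h4; lra.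
have w0 b : 0 < w b.
  by apply: lt_le_trans (wmin b); rewrite divr_gt0 // exprn_gt0.
have aE : area R lo hi = Y * Z by exact: areaE.
have aE' : area R lo (upd hi d cut) = X * Z.
  by rewrite (areaE _ _ _ d) /upd eqxx (_ : ~~ d == d = false) //; case: (d).
have XY : X <= Y by rewrite ler_nat leq_sub2r.
have X0 : 0 <= X by exact: ler0n.
have Z0 : 0 <= Z by exact: ler0n.
(* Both sides are at most [3 / 2] of the ideal ones, and [9 / 4 <= 3]. *)
have av : Y * Z / n%:R <= v.
  have /andP[_ Yw] := side d; have /andP[_ Zw] := side (~~ d).
  rewrite ler_pdivrMr //.
  apply: (@le_trans _ _ (3 / 2 * w d * (3 / 2 * w (~~ d)))).
    by apply: ler_pM => //; exact: le_trans XY.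
  have := ww; rewrite -/(w d) -/(w (~~ d)) => ww'.
  have : 0 < n%:R / 4 ^+ k :> R by rewrite divr_gt0 // exprn_gt0.
  rewrite /v -mulrA; nra.
set D := 16 * Num.sqrt (L * v).
have D1 : 1 <= D.
  have : 1 <= Num.sqrt (L * v) by rewrite -sqrtr1 ler_wsqrtr //; nra.
  by rewrite /D; lra.
have Ehi : `|#|cell s lo hi|%:R - Y * Z / n%:R| <= D.
  by rewrite -aE; apply: spread => //; rewrite aE.
have Ecut : `|(#|cell s lo hi|./2)%:R - X * Z / n%:R| <= D.
  rewrite -cutE -aE'; apply: spread => //.
  rewrite aE'; apply: le_trans av; rewrite ler_pM2r ?invr_gt0 //.
  exact: ler_wpM2r.
have hhalf : `|(#|cell s lo hi|./2)%:R - #|cell s lo hi|%:R / 2| <= 1 / 2 :> R.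
  move: #|cell s lo hi| => m; rewrite -{2}(odd_double_half m) -mul2n natrD natrM.
  by rewrite ler_norml; case: (odd m) => /=; lra.
have mid := midpoint_estimate nR (w0 (~~ d)) (proj1 (andP (side (~~ d)))) D1 hhalf Ecut Ehi.
(* By [wn] the left side is at most [128 * (Num.sqrt (L * v) * 2 ^+ k)], where the last product is
   the square root of [3 * L * n]. *)
have eps : 4 * D * n%:R / w (~~ d) <= 256 * Num.sqrt (L * n%:R).
  rewrite ler_pdivrMr //.
  have p2 : 0 < 2 ^+ k :> R by rewrite exprn_gt0.
  have s0 : 0 <= Num.sqrt (L * n%:R) by exact: sqrtr_ge0.
  have L0 : 0 <= L by lra.
  have v0 : 0 <= v by lra.
  have sv : Num.sqrt (L * v) * 2 ^+ k <= 2 * Num.sqrt (L * n%:R).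
    rewrite -ler_sqr ?nnegrE ?mulr_ge0 ?sqrtr_ge0 ?ltW //.
    rewrite !exprMn !sqr_sqrtr ?mulr_ge0 //.
    rewrite -exprM mulnC exprM (_ : 2 ^+ 2 = 4) /v; last by ring.
    rewrite -!mulrA mulVf ?mulr1; last by rewrite gt_eqF // exprn_gt0.
    nra.
  have := wn; rewrite -/(w (~~ d)) => wn'.
  apply: (@le_trans _ _ (4 * D * (w (~~ d) * (2 * 2 ^+ k)))).
    by rewrite ler_pM2l //; lra.
  have -> : 4 * D * (w (~~ d) * (2 * 2 ^+ k)) = 128 * w (~~ d) * (Num.sqrt (L * v) * 2 ^+ k).
    by rewrite /D; ring.
  have := w0 (~~ d); nra.
have cutmid : `|cut%:R - ((box R n c d).1 + (box R n c d).2) / 2| <= delta + 256 * Num.sqrt (L * n%:R).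
  have [/andP[lh _] h1 h2] := near d.
  move: mid; rewrite /X /Y !natrB // => mid.
  have {}mid := le_trans mid eps.
  by move: h1 h2 mid; rewrite !ler_norml => h1 h2 h3; lra.
exists cut => e lo' hi'.
have s0 : 0 <= Num.sqrt (L * n%:R) by exact: sqrtr_ge0.
split.
  move=> b; have [lhn h1 h2] := near b.
  have h1' : `|(lo b)%:R - (box R n c b).1| <= delta + 256 * Num.sqrt (L * n%:R) by lra.
  have h2' : `|(hi b)%:R - (box R n c b).2| <= delta + 256 * Num.sqrt (L * n%:R) by lra.
  rewrite /lo' /hi' /= -dE /upd; case: e {lo' hi'}; case: eqP => //= bd; rewrite ?bd in h1' h2' *;
    split => //; by [have := upl b; rewrite /upd bd eqxx|have := upr b; rewrite /upd bd eqxx].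
by rewrite /lo' /hi' /= -cM; case: e {lo' hi'}.
Qed.

(** Each of the [T] halvings adds at most [256 * Num.sqrt (L * n%:R)] to the distance from the ideal
    cell. *)
Lemma kd_tree (R : realType) (L : R) (n : nat) (s : 'S_n) (T : nat) :
  1 <= L -> (0 < n)%N -> evenly_spread L s ->
  64 * L <= 3 * n%:R / 4 ^+ T./2 ->
  4 * (T%:R * (256 * Num.sqrt (L * n%:R))) <= n%:R / 2 ^+ uphalf T ->
  exists2 f : 'I_n -> seq bool, forall i, size (f i) = T &
    forall c, size c = T -> #|[set i | f i == c]| = leaf_size n c /\
      forall i b, f i = c ->
        (box R n c b).1 - T%:R * (256 * Num.sqrt (L * n%:R)) <= (pcoord s b i)%:R
          <= (box R n c b).2 + T%:R * (256 * Num.sqrt (L * n%:R)).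
Proof.
move=> L1 n0 spread vT eT; set eps : R := 256 * Num.sqrt _ in eT *.
have eps0 : 0 <= eps by apply: mulr_ge0; [exact: ler0n | exact: sqrtr_ge0].
have nR : 0 < n%:R :> R by rewrite ltr0n.
have H j : (j <= T)%N -> exists2 f : 'I_n -> seq bool, forall i, size (f i) = j &
    forall c, size c = j -> exists lo hi, [/\ near_box n (j%:R * eps) c lo hi,
      [set i | f i == c] = cell s lo hi & #|cell s lo hi| = leaf_size n c].
  elim: j => [_|j IH jT].
    exists (fun=> [::]) => // -[] // _; exists (fun=> 0%N), (fun=> n).
    have cT : cell s (fun=> 0%N) (fun=> n) = finset.setT.
      apply/setP => i; rewrite !inE; apply/forallP => b; exact: pcoord_lt.
    rewrite cT cardsT card_ord; split => //.
      by move=> b; rewrite /= mul0r !subrr normr0 leqnn.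
  have [f fj fP] := IH (ltnW jT).
  (* One cut is fixed for every label of length [j]; labels of other lengths get the default [0]. *)
  have /choice[cut cutP] : forall c, exists cut : nat, size c = j ->
      exists lo hi, [set i | f i == c] = cell s lo hi /\ forall e,
        let lo' := if e then upd lo (odd j) cut else lo in
        let hi' := if e then hi else upd hi (odd j) cut in
        near_box n (j.+1%:R * eps) (e :: c) lo' hi' /\ #|cell s lo' hi'| = leaf_size n (e :: c).
    move=> c; case: (eqVneq (size c) j) => [cj|nj]; last by exists 0%N => cj; rewrite cj eqxx in nj.
    have [lo [hi [near fc cc]]] := fP c cj.
    have dE : odd j = odd (size c) by rewrite cj.
    have v64 : 64 * L <= 3 * n%:R / 4 ^+ (size c)./2.
      apply: le_trans vT _; rewrite ler_pM2l ?mulr_gt0 // lef_pV2 ?posrE ?exprn_gt0 //.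
      by rewrite ler_weXn2l ?ler1n // cj half_leq // ltnW.
    have d4 : 4 * (j%:R * eps) <= n%:R / 2 ^+ uphalf (size c).
      apply: (@le_trans _ _ (4 * (T%:R * eps))).
        by rewrite ler_pM2l // ler_wpM2r // ler_nat ltnW.
      apply: le_trans eT _; rewrite ler_pM2l // lef_pV2 ?posrE ?exprn_gt0 //.
      by rewrite ler_weXn2l ?ler1n // cj uphalf_leq // ltnW.
    have [k kP] := near_box_split L1 n0 spread dE v64 d4 near cc.
    exists k => _; exists lo, hi; split => // e.
    by have := kP e; rewrite -/eps -natr1 mulrDl mul1r.
  exists (fun i => (cut (f i) <= pcoord s (odd j) i)%N :: f i) => [i|[//|e c] /= [cj]].
    by rewrite /= fj.
  have [lo [hi [fc near]]] := cutP c cj; have [near_e cc] := near e.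
  have lo_cut : (lo (odd j) <= cut c)%N.
    by have [nf _] := near false; have [/andP[]] := nf (odd j); rewrite /upd eqxx.
  have cut_hi : (cut c <= hi (odd j))%N.
    by have [nt _] := near true; have [/andP[]] := nt (odd j); rewrite /upd eqxx.
  eexists; eexists; split; [exact: near_e| |exact: cc].
  apply/setP => i; have /setP/(_ i) := fc; rewrite !inE eqseq_cons => fic.
  have [fi|nfi] := eqVneq (f i) c; last first.
    rewrite andbF; apply/esym/negbTE; move: fic; rewrite (negbTE nfi) => /esym/negbT.
    apply: contra => /forallP a; apply/forallP => b; move: (a b); rewrite /upd.
    case: (e); case: eqP => // -> /andP[h1 h2].
      by rewrite h2 (leq_trans lo_cut).
    by rewrite h1 (leq_trans h2).
  move: fic; rewrite fi eqxx andbT => /esym/forallP a.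
  apply/eqP/forallP => [<- b|h].
    have := a b; rewrite /upd; case: (leqP (cut c)) => h /=; case: eqP => // -> /andP[h1 h2].
      by rewrite h h2.
    by rewrite h h1.
  have := h (odd j); rewrite /upd; case: (e); rewrite eqxx => /andP[h1 h2] //.
  by apply/negbTE; rewrite -ltnNge.
have [f fT fP] := H T (leqnn T).
exists f => // c cT; have [lo [hi [near fc cc]]] := fP c cT.
rewrite fc; split => // i b fi.
have /setP/(_ i) := fc; rewrite !inE fi eqxx => /esym/forallP/(_ b)/andP[h1 h2].
have [_] := near b; rewrite !ler_norml => /andP[a1 a2] /andP[a3 a4].
have : (lo b)%:R <= (pcoord s b i)%:R :> R by rewrite ler_nat.
have : (pcoord s b i)%:R <= (hi b)%:R :> R by rewrite ler_nat ltnW.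
lra.
Qed.

(** * Displacement classes and windows *)

Lemma card_le_inj_nat (T : finType) (A : {set T}) (h : T -> nat) (k : nat) :
  {in A &, injective h} -> (forall x, x \in A -> (h x < k)%N) -> (#|A| <= k)%N.
Proof.
move=> hI hk; rewrite cardE -(size_map h) -(size_iota 0 k); apply: uniq_leq_size.
  by rewrite map_inj_in_uniq ?enum_uniq // => x y; rewrite !mem_enum; exact: hI.
by move=> _ /mapP[x + ->]; rewrite mem_enum mem_iota add0n => /hk.
Qed.

Definition close (W x y : nat) : bool := (x < y + W)%N && (y < x + W)%N.

(* [shift W D x y] is the displacement from [x] to [y], offset by [D] to be nonnegative and
   rounded down to a multiple of [W]; it is meant for [x <= y + D]. *)
Definition shift (W D x y : nat) : nat := ((y + D - x) %/ W)%N.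

Lemma card_close (n W x0 : nat) : (#|[set x : 'I_n | close W x x0]| <= 2 * W)%N.
Proof.
apply: (card_le_inj_nat (h := fun x : 'I_n => (x + W - x0)%N)) => [x y|x]; rewrite !inE /close.
  by move=> hx hy e; apply: val_inj => /=; lia.
by lia.
Qed.

Lemma card_shift (n W D x a : nat) : (0 < W)%N ->
  (#|[set y : 'I_n | (x <= y + D)%N && (shift W D x y == a)]| <= W)%N.
Proof.
move=> W0; apply: (card_le_inj_nat (h := fun y : 'I_n => ((y + D - x) %% W)%N)) => [y z|y _].
  rewrite !inE /shift => /andP[hy /eqP ey] /andP[hz /eqP ez] e; apply: val_inj => /=.
  have := divn_eq (y + D - x) W; have := divn_eq (z + D - x) W.
  by rewrite ey ez e; lia.
exact: ltn_pmod.
Qed.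

(** Displacements in one class differ by less than [W], too little to reverse the order of points at
    distance at least [W]. *)
Lemma shift_mono (W D x y x' y' : nat) : (0 < W)%N -> (x <= y + D)%N -> (x' <= y' + D)%N ->
  shift W D x y = shift W D x' y' -> ~~ close W x x' -> (x < x')%N = (y < y')%N.
Proof.
rewrite /shift /close => W0 h h' e nc.
have := divn_eq (y + D - x) W; have := divn_eq (y' + D - x') W.
have := ltn_pmod (y + D - x) W0; have := ltn_pmod (y' + D - x') W0.
by rewrite e; lia.
Qed.

Lemma shift_le (W D x y : nat) : (y <= x + D)%N -> (shift W D x y < (2 * D) %/ W + 1)%N.
Proof. by move=> h; rewrite addn1 ltnS leq_div2r //; lia. Qed.

(** In the conflict graph two points are joined if they share both displacement classes and are
    close in some coordinate. Neighbourhoods have at most [2 * c] points, so [2 * c + 1] greedy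
    colours suffice; the full colour adds the pair of classes. *)
Lemma U_le_windows (n W D c : nat) (s p tau : 'S_n) : (0 < W)%N ->
  (forall x : 'I_n, [/\ (x <= tau x + D)%N, (tau x <= x + D)%N, (s x <= p (tau x) + D)%N
    & (p (tau x) <= s x + D)%N]) ->
  (forall x : 'I_n, let same (y : 'I_n) := (shift W D y (tau y) == shift W D x (tau x)) &&
       (shift W D (s y) (p (tau y)) == shift W D (s x) (p (tau x))) in
     (#|[set y : 'I_n | close W y x && same y]| <= c)%N /\
     (#|[set y : 'I_n | close W (s y) (s x) && same y]| <= c)%N) ->
  (U s p <= ((2 * D) %/ W + 1) ^ 2 * (2 * c + 1))%N.
Proof.
move=> W0 disp win; set K := (_ %/ W + 1)%N.
pose kx (x : 'I_n) := shift W D x (tau x); pose ky (x : 'I_n) := shift W D (s x) (p (tau x)).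
have kxK x : (kx x < K)%N by have [_ h _ _] := disp x; exact: shift_le.
have kyK x : (ky x < K)%N by have [_ _ _ h] := disp x; exact: shift_le.
pose same (x y : 'I_n) := (kx y == kx x) && (ky y == ky x).
pose e (x y : 'I_n) := (close W y x || close W (s y) (s x)) && same x y.
have closeC a b : close W a b = close W b a by rewrite /close andbC.
have es : symmetric e.
  by move=> x y; rewrite /e /same closeC (closeC (s x)) eq_sym (eq_sym (ky x)).
have ed (x : 'I_n) : (#|[set y | e x y]| < 2 * c + 1)%N.
  have [h1 h2] := win x; rewrite addn1 ltnS mul2n -addnn.
  apply: leq_trans (leq_add h1 h2).
  apply: (@leq_trans #|[set y : 'I_n | close W y x && same x y] :|:
    [set y : 'I_n | close W (s y) (s x) && same x y]|); last exact: leq_card_setU.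
  by apply: subset_leq_card; apply/fintype.subsetP => y; rewrite !inE /e andb_orl.
have [col colP] := greedy_colouring es ed.
pose C := ('I_K * 'I_K * 'I_(2 * c + 1))%type.
have -> : (K ^ 2 * (2 * c + 1))%N = #|{: C}| by rewrite !card_prod !card_ord mulnn.
pose f (x : 'I_n) : C := (Ordinal (kxK x), Ordinal (kyK x), col x).
have fP (x y : 'I_n) : f x = f y -> x != y ->
    [/\ kx x = kx y, ky x = ky y, ~~ close W x y & ~~ close W (s x) (s y)].
  move=> [e1 e2 e3] xy.
  have : ~~ e x y by apply/negP => /(colP x y xy); rewrite e3 eqxx.
  rewrite /e /same e1 e2 !eqxx !andbT.
  by rewrite negb_or (closeC y) (closeC (s y)) => /andP[c1 c2]; split.
apply: (@U_le_card n C s p tau f) => x y fxy.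
  have [->|xy] := eqVneq x y; first by rewrite !ltxx.
  have [e1 _ nc _] := fP x y fxy xy.
  have [h _ _ _] := disp x; have [h' _ _ _] := disp y.
  exact: (shift_mono W0 h h' e1 nc).
have [->|xy] := eqVneq x y; first by rewrite !ltxx.
have [_ e2 _ nc] := fP x y fxy xy.
have [_ _ h _] := disp x; have [_ _ h' _] := disp y.
exact: (shift_mono W0 h h' e2 nc).
Qed.

Lemma relabellings_neq0 (n : nat) (K : eqType) (f g : 'I_n -> K) :
  (forall c, #|[set i | f i == c]| = #|[set i | g i == c]|) -> (0 < #|relabellings f g|)%N.
Proof.
move=> fg; pose tf := [tuple f i | i < n]; pose tg := [tuple g i | i < n].
have cnt (h : 'I_n -> K) c : count_mem c [tuple h i | i < n] = #|[set i | h i == c]|.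
  by rewrite /= count_map cardsE cardE size_filter enumT; apply: eq_count.
have /tuple_permP[tau tauE] : perm_eq tf tg.
  by apply/allP => c _; apply/eqP; rewrite !cnt.
rewrite card_gt0; apply/set0Pn; exists tau; rewrite inE; apply/forallP => x; apply/eqP.
have : tnth tf x = tnth [tuple tnth tg (tau i) | i < n] x by congr tnth; apply: val_inj.
by rewrite !tnth_mktuple.
Qed.

Lemma card_sub_prod (A B : finType) (P : pred A) (R : A -> pred B) (k : nat) :
  (forall a, (#|[set b | R a b]| <= k)%N) ->
  (#|[set z : A * B | P z.1 && R z.1 z.2]| <= #|[set a | P a]| * k)%N.
Proof.
move=> Rk; rewrite -sum1_card.
rewrite (eq_bigl (fun z : A * B => P z.1 && R z.1 z.2)); last by move=> z; rewrite inE.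
rewrite -(pair_big_dep P (fun a b => R a b) (fun _ _ => 1%N)) /= -sum_nat_const.
rewrite [X in (_ <= X)%N](eq_bigl P); last by move=> a; rewrite inE.
apply: leq_sum => a _; apply: leq_trans (Rk a); rewrite sum1_card.
by apply: subset_leq_card; apply/fintype.subsetP => b; rewrite inE.
Qed.

(** A window consists of a direction, the centre of a strip in that direction, and two displacement
    classes. The inequalities with [D] keep the subtraction in [shift] from truncating. *)
Definition window (n W D K : nat) (w : bool * 'I_n * ('I_K * 'I_K)) :
    {set pairing n} :=
  [set z : pairing n | close W (if w.1.1 then z.1.2 else z.1.1) w.1.2 &&
    (((z.1.1 <= z.2.1 + D)%N && (shift W D z.1.1 z.2.1 == w.2.1)) &&
     ((z.1.2 <= z.2.2 + D)%N && (shift W D z.1.2 z.2.2 == w.2.2)))].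

(** There are [2 * W] choices for the coordinate in the strip, [n] for the other one, and [W] for
    each coordinate of the second point. *)
Lemma card_window (n W D K : nat) (w : bool * 'I_n * ('I_K * 'I_K)) : (0 < W)%N ->
  (#|window W D w| <= 2 * n * W ^ 3)%N.
Proof.
move=> W0; case: w => -[b x0] [a a']; rewrite /window /=.
pose P (z : 'I_n * 'I_n) := close W ((if b then z.2 else z.1) : 'I_n) x0.
pose R (z y : 'I_n * 'I_n) := ((z.1 <= y.1 + D)%N && (shift W D z.1 y.1 == a)) &&
     ((z.2 <= y.2 + D)%N && (shift W D z.2 y.2 == a')).
have RW z : (#|[set y | R z y]| <= W * W)%N.
  apply: leq_trans (@card_sub_prod _ _ (fun y : 'I_n => (z.1 <= y + D)%N && (shift W D z.1 y == a))
    (fun _ => fun y : 'I_n => (z.2 <= y + D)%N && (shift W D z.2 y == a')) W _) _.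
    by move=> _; exact: card_shift.
  by rewrite leq_mul2r card_shift ?orbT.
apply: leq_trans (card_sub_prod P RW) _.
have : (#|[set z | P z]| <= 2 * W * n)%N.
  case: (b) @P => P.
    rewrite (_ : [set z | P z] = finset.setX finset.setT [set x : 'I_n | close W x x0]).
      by rewrite cardsX cardsT card_ord mulnC leq_mul2r card_close orbT.
    by apply/setP => -[x y]; rewrite !inE.
  rewrite (_ : [set z | P z] = finset.setX [set x : 'I_n | close W x x0] finset.setT).
    by rewrite cardsX cardsT card_ord leq_mul2r card_close orbT.
  by apply/setP => -[x y]; rewrite !inE andbT.
by move=> h; apply: leq_trans (leq_mul h (leqnn _)) _; rewrite !expnS expn0; lia.
Qed.

(** The windows form a family fixed in advance, independent of [s], [p] and [tau], as a union bound
    requires. *)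
Lemma U_le_window_load (n W D c : nat) (s p tau : 'S_n) : (0 < W)%N ->
  (forall x : 'I_n, [/\ (x <= tau x + D)%N, (tau x <= x + D)%N, (s x <= p (tau x) + D)%N
    & (p (tau x) <= s x + D)%N]) ->
  (forall w : bool * 'I_n * ('I_((2 * D) %/ W + 1) * 'I_((2 * D) %/ W + 1)),
     (#|[set z in window W D w | paired s p tau z]| <= c)%N) ->
  (U s p <= ((2 * D) %/ W + 1) ^ 2 * (2 * c + 1))%N.
Proof.
move=> W0 disp load; apply: (U_le_windows W0 disp) => x same.
have kxK : (shift W D x (tau x) < (2 * D) %/ W + 1)%N by have [_ h _ _] := disp x; exact: shift_le.
have kyK : (shift W D (s x) (p (tau x)) < (2 * D) %/ W + 1)%N.
  by have [_ _ _ h] := disp x; exact: shift_le.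
pose w b x0 : bool * 'I_n * _ := (b, x0, (Ordinal kxK, Ordinal kyK)).
have inj : injective (fun y : 'I_n => ((y, s y), (tau y, p (tau y)))) by move=> y z [].
by split; [apply: leq_trans (load (w false x))|apply: leq_trans (load (w true (s x)))];
  rewrite -(card_imset _ inj); apply: subset_leq_card; apply/fintype.subsetP => _ /imsetP[y + ->];
  rewrite !inE /= /paired /= !eqxx andbT => /andP[-> /andP[-> ->]];
  have [-> _ -> _] := disp y.
Qed.

(** A relabelling that overloads no window would make [U] small, so a large [U] means that every
    relabelling overloads one. *)
Lemma card_U_large (n W D m t c : nat) (lab : 'S_n -> 'I_n -> seq bool) (G : {set 'S_n}) :
  (0 < W)%N ->
  (forall s y, s \in G -> (m <= #|[set j | lab s j == lab s y]|)%N) ->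
  (forall s p a, s \in G -> p \in G -> #|[set j | lab s j == a]| = #|[set j | lab p j == a]|) ->
  (forall s p x y b, s \in G -> p \in G -> lab s x = lab p y ->
    (pcoord s b x <= pcoord p b y + D)%N) ->
  (#|[set sp : 'S_n * 'S_n | [&& sp.1 \in G, sp.2 \in G &
       (((2 * D) %/ W + 1) ^ 2 * (2 * c + 1) < U sp.1 sp.2)%N]]|
    * (c ^_ t * m ^_ t * (n ^_ t) ^ 2)
   <= 2 * n * ((2 * D) %/ W + 1) ^ 2 * (2 * n * W ^ 3) ^ t * n`! ^ 2)%N.
Proof.
move=> W0 fib eqsz disp.
have R0 s p : s \in G -> p \in G -> (0 < #|relabellings (lab s) (lab p)|)%N.
  by move=> sG pG; apply: relabellings_neq0 => a; exact: eqsz.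
set K := ((2 * D) %/ W + 1)%N.
have := card_overcrowded t c fib R0 (fun w => card_window D (K := K) w W0).
rewrite !card_prod card_bool !card_ord mulnn; apply: leq_trans; rewrite leq_mul2r; apply/orP; right.
apply: subset_leq_card; apply/fintype.subsetP => -[s p]; rewrite !inE /=.
move=> /and3P[sG pG]; rewrite sG pG /=.
apply: contraTT; rewrite -leqNgt => /fintype.forall_inPn[tau tauR].
rewrite negb_exists => /forallP load.

have tau_lab x : lab p (tau x) = lab s x by move: tauR; rewrite inE => /forallP/(_ x)/eqP.
apply: (@U_le_window_load n W D c s p tau W0) => [x|w].
  split; [apply: (disp s p x (tau x) false)|apply: (disp p s (tau x) x false)
         |apply: (disp s p x (tau x) true)|apply: (disp p s (tau x) x true)] => //; by rewrite tau_lab.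
by have := load w; rewrite -ltnNge => /ltnW.
Qed.

(** * Evenly spread pairs with crowded windows *)

(** The tree has depth [2 * k], with [k] halvings in each direction. Points with equal labels lie in
    one ideal box of side [n / 2 ^+ k], enlarged by at most a quarter of the side at each end; hence
    the factor [3 / 2]. *)
Lemma card_crowded_spread (R : realType) (L : R) (n k m D W t c : nat) :
  1 <= L -> (0 < n)%N -> (0 < W)%N ->
  64 * L <= 3 * n%:R / 4 ^+ k ->
  4 * ((2 * k)%:R * (256 * Num.sqrt (L * n%:R))) <= n%:R / 2 ^+ k ->
  m%:R + 1 <= n%:R / 4 ^+ k :> R ->
  3 / 2 * (n%:R / 2 ^+ k) <= D%:R :> R ->
  (#|[set sp : 'S_n * 'S_n | [&& `[< evenly_spread L sp.1 >], `[< evenly_spread L sp.2 >] &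
       (((2 * D) %/ W + 1) ^ 2 * (2 * c + 1) < U sp.1 sp.2)%N]]|
    * (c ^_ t * m ^_ t * (n ^_ t) ^ 2)
   <= 2 * n * ((2 * D) %/ W + 1) ^ 2 * (2 * n * W ^ 3) ^ t * n`! ^ 2)%N.
Proof.
move=> L1 n0 W0 v64 d4 hm hD.
have half2k : ((2 * k)./2 = k)%N by lia.
have uphalf2k : (uphalf (2 * k) = k)%N by lia.
have /choice[lab labP] : forall s : 'S_n, exists f : 'I_n -> seq bool, evenly_spread L s ->
    (forall i, size (f i) = 2 * k)%N /\
    forall a, size a = (2 * k)%N -> #|[set i | f i == a]| = leaf_size n a /\
      forall i b, f i = a ->
        (box R n a b).1 - (2 * k)%:R * (256 * Num.sqrt (L * n%:R)) <= (pcoord s b i)%:R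
          <= (box R n a b).2 + (2 * k)%:R * (256 * Num.sqrt (L * n%:R)).
  move=> s; have [sp|nsp] := pselect (evenly_spread L s); last by exists (fun=> [::]).
  have [||f f1 f2] := kd_tree (T := (2 * k)%N) L1 n0 sp; rewrite ?half2k ?uphalf2k //.
  by exists f.
pose G := [set s : 'S_n | `[< evenly_spread L s >]].
have GP s : s \in G -> evenly_spread L s by rewrite inE => h; apply/asboolP.
have fib s y : s \in G -> (m <= #|[set j | lab s j == lab s y]|)%N.
  move=> /GP ss; have [sz /(_ (lab s y) (sz y))[-> _]] := labP s ss.
  rewrite -(ler_nat R); have := leaf_size_near R n (lab s y).
  rewrite sz exprM (_ : 2 ^+ 2 = 4) ?ler_norml; last by ring.
  by move=> /andP[h _]; lra.
have eqsz s p a : s \in G -> p \in G -> #|[set j | lab s j == a]| = #|[set j | lab p j == a]|.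
  move=> /GP ss /GP pp; have [szs hs] := labP s ss; have [szp hp] := labP p pp.
  have [sa|na] := eqVneq (size a) (2 * k)%N; first by rewrite (hs a sa).1 (hp a sa).1.
  (* A label of the wrong length occurs for neither permutation. *)
  have no f : (forall i : 'I_n, size (f i) = 2 * k)%N -> [set j | f j == a] = finset.set0.
    by move=> sz; apply/setP => j; rewrite !inE; apply: contra_neqF na => /eqP <-.
  by rewrite !no.
have disp s p x y b : s \in G -> p \in G -> lab s x = lab p y ->
    (pcoord s b x <= pcoord p b y + D)%N.
  move=> /GP ss /GP pp e; have [szs hs] := labP s ss; have [szp hp] := labP p pp.
  have [_ /(_ x b erefl) /andP[_ hx]] := hs _ (szs x).
  have [_ /(_ y b (esym e)) /andP[hy _]] := hp _ (szs x).
  have := box_width R n (lab s x) b.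
  rewrite szs half2k uphalf2k if_same => wd.
  by rewrite -(ler_nat R) natrD; lra.
have H := @card_U_large n W D m t c lab G W0 fib eqsz disp.
apply: leq_trans H; rewrite leq_mul2r; apply/orP; right.
by apply: subset_leq_card; apply/fintype.subsetP => sp; rewrite !inE.
Qed.

(** * Numerical estimates and choice of parameters *)

Lemma ffact_ge_exp (n t : nat) : ((n - t) ^ t <= n ^_ t)%N.
Proof.
suff H k : (k <= t)%N -> ((n - t) ^ k <= n ^_ k)%N by exact: H.
elim: k => // k IH kt; rewrite expnSr ffactnSr leq_mul ?IH ?leq_sub2l // ltnW //.
Qed.

Lemma U_le_n (n : nat) (s p : 'S_n) : (U s p <= n)%N.
Proof.
rewrite -[X in (_ <= X)%N]card_ord.
by apply: (@U_le_card n 'I_n s p 1%g id) => x y ->; rewrite !ltxx.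
Qed.

(** On [Bad] the trivial bound [n] is used, and this contributes at most [1]. *)
Lemma expected_U_le (R : realType) (n B : nat) (Bad : {set 'S_n * 'S_n}) :
  (forall sp, sp \notin Bad -> (U sp.1 sp.2 <= B)%N) ->
  #|Bad|%:R * n%:R <= (n`! ^ 2)%:R :> R -> expected_U R n <= B%:R + 1.
Proof.
move=> UB bad; rewrite /expected_U /expect /indep_pmf /unif_pmf -big_distrr /=.
have n2 : 0 < (n`! ^ 2)%:R :> R by rewrite ltr0n expn_gt0 fact_gt0.
rewrite card_Sn -invfM -natrM mulnn mulrC ler_pdivrMr //.
rewrite (bigID (mem Bad)) /= addrC mulrDl mul1r; apply: lerD; last first.
  apply: le_trans bad; rewrite mulr_natl -sumr_const; apply: ler_sum => sp _.
  by rewrite ler_nat U_le_n.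
apply: (@le_trans _ _ (\sum_(sp : 'S_n * 'S_n) B%:R)); last first.
  by rewrite sumr_const card_prod card_Sn mulnn mulr_natr.
rewrite [X in _ <= X](bigID (mem Bad)) /= -[X in X <= _]add0r; apply: lerD.
  by apply: sumr_ge0.
by apply: ler_sum => sp /UB; rewrite ler_nat.
Qed.

Lemma expR1_le4 (R : realType) : expR 1 <= 4 :> R.
Proof.
have h : 2^-1 <= expR (- 2^-1) :> R by apply: le_trans (expR_ge1Dx _); lra.
have {h} : expR 2^-1 <= 2 :> R.
  by rewrite -[2^-1]opprK expRN invf_ple ?posrE ?expR_gt0.
have -> : expR 1 = expR 2^-1 ^+ 2 :> R by rewrite -expRM_natl; congr expR; field.
by have := expR_ge0 (2^-1 : R); rewrite expr2 => *; nra.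
Qed.

Lemma expR_ge_exp8 (R : realType) (x : R) : 0 <= x -> (x / 8) ^+ 8 <= expR x.
Proof.
move=> x0; rewrite [X in _ <= expR X](_ : x = 8%:R * (x / 8)); last by field.
rewrite expRM_natl lerXn2r ?nnegrE ?expR_ge0 ?divr_ge0 //.
by apply: le_trans (expR_ge1Dx _); lra.
Qed.

Lemma pow4_scale (R : realType) (n : nat) (a : R) : 0 < a -> a <= n%:R ->
  exists2 k, a <= n%:R / 4 ^+ k & n%:R / 4 ^+ k <= 4 * a.
Proof.
move=> a0 an; pose y := Num.truncn (n%:R / a).
have x1 : 1 <= n%:R / a by rewrite ler_pdivlMr // mul1r.
have y0 : (0 < y)%N by rewrite truncn_gt0.
have /andP[h1 h2] := truncn_itv (le_trans ler01 x1).
have /andP[k1 k2] := trunc_log_bounds (isT : 1 < 4)%N y0.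
exists (trunc_log 4 y); set k := trunc_log 4 y in k1 k2 *.
have p k' : 0 < 4 ^+ k' :> R by rewrite exprn_gt0.
  rewrite ler_pdivlMr // mulrC -ler_pdivlMr //; apply: le_trans h1.
  by rewrite -natrX ler_nat.
rewrite ler_pdivrMr // -mulrA mulrCA -ler_pdivrMl // mulrC -exprS -natrX.
by apply: (le_trans (ltW h2)); rewrite ler_nat.
Qed.

Lemma exponent_le_ln (R : realType) (n k : nat) : (0 < n)%N -> 1 <= n%:R / 4 ^+ k :> R ->
  k%:R <= ln n%:R :> R.
Proof.
move=> n0; rewrite ler_pdivlMr ?exprn_gt0 // mul1r => h.
rewrite -ler_expR lnK ?posrE ?ltr0n //; apply: le_trans h.
by rewrite -[k%:R]mulr1 expRM_natl lerXn2r ?nnegrE ?expR_ge0 ?expR1_le4.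
Qed.

(* Each falling factorial is at least a power, so the bound on [b] decays like [e^{-t}]. *)
Lemma crowded_decay (R : realType) (n m t b V q f : nat) :
  (b * ((2 * t) ^_ t * m ^_ t * (n ^_ t) ^ 2) <= V * q ^ t * f)%N ->
  expR 1 * q%:R <= (t * (m - t) * (n - t) ^ 2)%:R :> R ->
  (0 < t * (m - t) * (n - t) ^ 2)%N ->
  b%:R <= V%:R * f%:R * expR (- t%:R) :> R.
Proof.
set Y := (t * (m - t) * (n - t) ^ 2)%N => H qY Y0.
have Yt : (Y ^ t <= (2 * t) ^_ t * m ^_ t * (n ^_ t) ^ 2)%N.
  rewrite /Y -!mulnn !expnMn !leq_mul ?ffact_ge_exp //.
  by apply: leq_trans (ffact_ge_exp _ _); rewrite mul2n -addnn addnK.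
have {H} : (b * Y ^ t <= V * q ^ t * f)%N.
  by apply: leq_trans H; rewrite leq_mul2l Yt orbT.
rewrite -(ler_nat R) !natrM !natrX => H.
have YR : 0 < Y%:R :> R by rewrite ltr0n.
have Ytp : 0 < Y%:R ^+ t :> R by rewrite exprn_gt0.
rewrite -(ler_pM2r Ytp); apply: le_trans H _.
rewrite -!mulrA ler_wpM2l // mulrC ler_wpM2l //.
rewrite expRN -ler_pdivrMl ?invr_gt0 ?expR_gt0 // invrK -[t%:R]mulr1 expRM_natl -exprMn.
by rewrite lerXn2r ?nnegrE ?mulr_ge0 ?expR_ge0.
Qed.

Lemma ln_pow4_le (R : realType) (n : nat) (L : R) : (0 < n)%N -> L = ln n%:R -> 2 ^+ 22 <= L ->
  2 ^+ 40 * L ^+ 4 <= n%:R.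
Proof.
move=> n0 LE L22.
have L0 : 0 <= L by apply: le_trans L22; rewrite exprn_ge0.
have -> : n%:R = expR L by rewrite LE lnK // posrE ltr0n.
apply: le_trans (expR_ge_exp8 L0).
have -> : (L / 8) ^+ 8 = L ^+ 4 * (L ^+ 4 / 2 ^+ 24) by field.
rewrite mulrC ler_wpM2l ?exprn_ge0 // ler_pdivlMr ?exprn_gt0 //.
rewrite -exprD; apply: (@le_trans _ _ ((2 ^+ 22) ^+ 4)).
  by rewrite -exprM ler_weXn2l // ler1n.
by rewrite lerXn2r ?nnegrE // exprn_ge0.
Qed.

(** The depth is chosen so that [n / 4 ^+ k] lies between [L ^+ 4] and [4 * L ^+ 4]. The accumulated
    error has order [Num.sqrt n%:R] times [L] to the [3 / 2], while the side is at least
    [Num.sqrt n%:R * L ^+ 2]; the spare factor [Num.sqrt L] absorbs the constant [2 ^+ 11], whence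
    the threshold [2 ^+ 22]. *)
Lemma tree_depth (R : realType) (n : nat) (L : R) : (0 < n)%N -> L = ln n%:R -> 2 ^+ 22 <= L ->
  exists k, [/\ 64 * L <= 3 * n%:R / 4 ^+ k, L ^+ 4 <= n%:R / 4 ^+ k,
    4 * ((2 * k)%:R * (256 * Num.sqrt (L * n%:R))) <= n%:R / 2 ^+ k
    & n%:R / 2 ^+ k <= 2 * (Num.sqrt n%:R * L ^+ 2)].
Proof.
move=> n0 LE L22.
have N0 : 0 < n%:R :> R by rewrite ltr0n.
have L1 : 4 <= L by apply: le_trans L22; lra.
have L0 : 0 <= L by lra.
have L4 : 1 <= L ^+ 4 by rewrite exprn_ege1 //; lra.
have Lp : 0 < L ^+ 4 by lra.
have LN : L ^+ 4 <= n%:R.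
  by apply: le_trans (ln_pow4_le n0 LE L22); rewrite ler_peMl ?exprn_ge0 ?exprn_ege1 ?ler1n //; lra.
have [k k1 k2] := pow4_scale Lp LN.
have kL : k%:R <= L by rewrite LE exponent_le_ln // (le_trans L4).
exists k.
set a := n%:R / 2 ^+ k.
have a0 : 0 <= a by rewrite divr_ge0 ?exprn_ge0.
have aE : a ^+ 2 = n%:R * (n%:R / 4 ^+ k).
  by rewrite /a expr_div_n -exprM mulnC exprM (_ : 2 ^+ 2 = 4 :> R) ?expr2 ?mulrA //; ring.
set r := Num.sqrt n%:R; have r0 : 0 <= r by exact: sqrtr_ge0.
have rE : r ^+ 2 = n%:R by rewrite sqr_sqrtr // ltW.
set q := Num.sqrt L; have q0 : 0 <= q by exact: sqrtr_ge0.
have qE : q ^+ 2 = L by rewrite sqr_sqrtr //; lra.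
have q11 : 2 ^+ 11 <= q.
  by rewrite -ler_sqr ?nnegrE ?exprn_ge0 // qE -exprM.
have ra : r * L ^+ 2 <= a.
  rewrite -ler_sqr ?nnegrE ?mulr_ge0 ?exprn_ge0 //.
  rewrite aE (_ : (r * L ^+ 2) ^+ 2 = r ^+ 2 * L ^+ 4); last by ring.
  by rewrite rE ler_wpM2l // ltW.
have ar : a <= 2 * (r * L ^+ 2).
  rewrite -ler_sqr ?nnegrE ?mulr_ge0 ?exprn_ge0 //.
  rewrite aE (_ : (2 * (r * L ^+ 2)) ^+ 2 = 4 * (r ^+ 2 * L ^+ 4)); last by ring.
  by rewrite rE [X in _ <= X]mulrCA ler_wpM2l // ltW.
split => //.
  rewrite -mulrA; apply: (@le_trans _ _ (3 * L ^+ 4)); last by rewrite ler_pM2l.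
  have : 64 <= L ^+ 3.
    rewrite (_ : 64 = 4 ^+ 3 :> R); last by ring.
    by rewrite lerXn2r ?nnegrE.
  by rewrite exprS; nra.
apply: le_trans ra; rewrite sqrtrM //.
rewrite -/q -/r natrM.
have -> : 4 * (2 * k%:R * (256 * (q * r))) = 2 ^+ 11 * k%:R * q * r by ring.
have -> : r * L ^+ 2 = q * L * q * r by transitivity (q ^+ 2 * L * r); [rewrite qE; ring|ring].
by rewrite ler_wpM2r // ler_wpM2r // ler_pM // exprn_ge0.
Qed.

Lemma powR_third_pow3 (R : realType) (a : R) : 0 <= a -> (a `^ (1 / 3)) ^+ 3 = a.
Proof. by move=> a0; rewrite -powR_mulrn ?powR_ge0 // -powRrM mul1r mulVf // powRr1. Qed.

Lemma ler_pow3 (R : realFieldType) (x y : R) : 0 <= x -> 0 <= y -> (x ^+ 3 <= y ^+ 3) = (x <= y).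
Proof. by move=> x0 y0; rewrite ler_pXn2r. Qed.

Lemma truncn_half (R : realType) (x : R) : 1 <= x ->
  [/\ (0 < Num.truncn x)%N, (Num.truncn x)%:R <= x & x / 2 <= (Num.truncn x)%:R].
Proof.
move=> x1; have x0 : 0 <= x by lra.
have t0 : (0 < Num.truncn x)%N by rewrite truncn_gt0.
have /andP[h1 h2] := truncn_itv x0; split => //.
have : 1 <= (Num.truncn x)%:R :> R by rewrite ler1n.
by move: h2; rewrite -natr1 => *; lra.
Qed.

Lemma truncnS_bounds (R : realType) (x : R) : 0 <= x ->
  x <= (Num.truncn x).+1%:R <= x + 1.
Proof. by move=> x0; have /andP[h1 h2] := truncn_itv x0; rewrite ltW // -natr1 lerD2r. Qed.

Lemma window_count_le (R : realType) (D W : nat) (P X : R) :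
  0 < X -> X <= P -> (0 < W)%N -> X / 2 <= W%:R -> D%:R <= 4 * P ->
  ((2 * D) %/ W + 1)%:R <= 17 * (P / X).
Proof.
move=> X0 XP W0 XW DP; have WR : 0 < W%:R :> R by rewrite ltr0n.
have : (((2 * D) %/ W) * W)%:R <= (2 * D)%:R :> R by rewrite ler_nat leq_trunc_div.
rewrite !natrM natrD; set u := ((2 * D) %/ W)%:R => h.
have u0 : 0 <= u by exact: ler0n.
rewrite mulrA ler_pdivlMr //; nra.
Qed.

(* [W ~ (n L^5)^{1/3}] makes the expected load of a window at most a small multiple of [t], so
   that a load of [2 t] has probability at most [e^{-t}]. *)
Lemma crowded_spread_rare (R : realType) (n : nat) (L X : R) : (0 < n)%N -> L = ln n%:R ->
  2 ^+ 22 <= L -> X = (n%:R * L ^+ 5 / 16) `^ (1 / 3) ->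
  exists B : nat, B%:R <= 2 ^+ 19 * X /\
    #|[set sp : 'S_n * 'S_n | [&& `[< evenly_spread L sp.1 >], `[< evenly_spread L sp.2 >] &
       (B < U sp.1 sp.2)%N]]|%:R * (4 * n%:R) <= (n`! ^ 2)%:R :> R.
Proof.
move=> n0 LE L22 XE.
have N0 : 0 < n%:R :> R by rewrite ltr0n.
have L100 : 100 <= L.
  apply: le_trans L22; apply: (@le_trans _ _ (2 ^+ 7)); first by rewrite -natrX ler_nat.
  by rewrite ler_weXn2l // ler1n.
have L0 : 0 <= L by lra.
have L4big : 100 * L <= L ^+ 4.
  by rewrite (exprSr L 3) ler_wpM2r // (le_trans L100) // ler_eXnr //; lra.
have LN := ln_pow4_le n0 LE L22.
have L4N : 2 ^+ 10 * L ^+ 4 <= n%:R.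
  by apply: le_trans LN; rewrite ler_wpM2r ?exprn_ge0 // ler_weXn2l // ler1n.
have [k [k1 k2 k3 k4]] := tree_depth n0 LE L22.
set P := Num.sqrt n%:R * L ^+ 2 in k4.
have P2 : P ^+ 2 = n%:R * L ^+ 4.
  transitivity (Num.sqrt n%:R ^+ 2 * L ^+ 4 : R); first by rewrite /P; ring.
  by rewrite sqr_sqrtr // ltW.
have P0 : 0 <= P by rewrite mulr_ge0 ?sqrtr_ge0 ?exprn_ge0.
have X0 : 0 <= X by rewrite XE powR_ge0.
have X3 : X ^+ 3 = n%:R * L ^+ 5 / 16.
  by rewrite XE powR_third_pow3 // divr_ge0 // mulr_ge0 // exprn_ge0.
have NL : 100 * L <= n%:R.
  by apply: (le_trans L4big); apply: le_trans L4N; rewrite ler_peMl ?exprn_ge0 ?exprn_ege1 ?ler1n.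
have X1 : 1 <= X.
  rewrite -ler_pow3 // expr1n X3 ler_pdivlMr // mul1r.
  rewrite -[16]mulr1; apply: ler_pM => //; [lra | by rewrite exprn_ege1 //; lra].
have XP : X <= P.
  rewrite -ler_pow3 // X3 (_ : P ^+ 3 = P ^+ 2 * P); last by ring.
  rewrite P2 (_ : n%:R * L ^+ 5 / 16 = n%:R * L ^+ 4 * (L / 16)); last by field.
  apply: ler_wpM2l; first by rewrite mulr_ge0 ?exprn_ge0 // ltW.
  have s1 : 1 <= Num.sqrt n%:R :> R by rewrite -[X in X <= _]sqrtr1 ler_wsqrtr // ler1n.
  apply: (@le_trans _ _ L); first lra.
  rewrite /P; apply: (@le_trans _ _ (L ^+ 2)); first by rewrite ler_eXnr //; lra.
  by rewrite ler_peMl ?exprn_ge0.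
have [W0 WX XW] := truncn_half X1.
have [t1 t2] := andP (truncnS_bounds (mulr_ge0 (ler0n R 10) L0)).
have [D1 D2] := andP (truncnS_bounds (mulr_ge0 (ler0n R 3) P0)).
have m0 : 0 <= L ^+ 4 - 1 by lra.
have [m1 m2] := andP (truncn_itv m0).
(* Roughly, [t] is [10 * L] for a failure rate of [n ^- 10], [D] is [3 * P] as displacements are at
   most [3 / 2] of a side of at most [2 * P], and [m] allows for the rounding of cell sizes. *)
set W := Num.truncn X in W0 WX XW; set t := (Num.truncn (10%:R * L)).+1 in t1 t2.
set D := (Num.truncn (3%:R * P)).+1 in D1 D2; set m := Num.truncn (L ^+ 4 - 1) in m1 m2.
exists (((2 * D) %/ W + 1) ^ 2 * (2 * (2 * t) + 1))%N.
have D4 : D%:R <= 4 * P by lra.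
have K17 := window_count_le (lt_le_trans ltr01 X1) XP W0 XW D4.
have L1 : 1 <= L by lra.
have km : m%:R + 1 <= n%:R / 4 ^+ k :> R by lra.
have kD : 3 / 2 * (n%:R / 2 ^+ k) <= D%:R :> R by lra.
have H := card_crowded_spread t (2 * t) L1 n0 W0 k1 k3 km kD.
set K := ((2 * D) %/ W + 1)%N in K17 H *.
have PX0 : 0 <= P / X by rewrite divr_ge0.
have K0 : 0 <= K%:R :> R by exact: ler0n.
have KN : K%:R <= n%:R :> R.
  apply: (le_trans K17); apply: (@le_trans _ _ (2 ^+ 5 * P)).
    apply: ler_pM => //; first by rewrite -natrX ler_nat.
    by rewrite ler_pdivrMr ?(lt_le_trans ltr01 X1) // ler_peMr.
  have h : (2 ^+ 5 * P) ^+ 2 <= n%:R ^+ 2.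
    rewrite (_ : (2 ^+ 5 * P) ^+ 2 = 2 ^+ 10 * P ^+ 2); last by ring.
    by rewrite P2 mulrCA expr2 ler_wpM2l // ltW.
  by move: h; rewrite ler_sqr // nnegrE ?ler0n // mulr_ge0 // exprn_ge0.
split.
  have t45 : (2 * (2 * t) + 1)%:R <= 2 ^+ 6 * L.
    rewrite natrD !natrM; have : 45 <= 2 ^+ 6 :> R by rewrite -natrX ler_nat.
    nra.
  rewrite natrM natrX; apply: (@le_trans _ _ ((2 ^+ 9 * (P / X) ^+ 2) * (2 ^+ 6 * L))).
    apply: ler_pM => //.
    apply: (@le_trans _ _ ((17 * (P / X)) ^+ 2)); first by rewrite lerXn2r // nnegrE mulr_ge0.
    rewrite exprMn ler_wpM2r ?exprn_ge0 // -!natrX ler_nat //.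
  (* The choice of [X] makes [P ^+ 2 * L] equal to [16 * X ^+ 3], so the bound collapses to
     [2 ^+ 15 * 16 * X]. *)
  rewrite expr_div_n P2 (_ : n%:R * L ^+ 4 = 16 * X ^+ 3 / L); last by rewrite X3; field; lra.
  have Xn0 : X != 0 by rewrite gt_eqF // (lt_le_trans ltr01 X1).
  have Ln0 : L != 0 by rewrite gt_eqF //; lra.
  by rewrite le_eqVlt; apply/orP; left; apply/eqP; field; rewrite Xn0.
have tm : (t <= m)%N by rewrite -(ler_nat R); lra.
have tn : (t <= n)%N by rewrite -(ler_nat R); lra.
have mt : L ^+ 4 / 2 <= (m - t)%:R by rewrite natrB //; move: m2; rewrite -natr1 => *; lra.
have nt : n%:R / 2 <= (n - t)%:R :> R by rewrite natrB //; lra.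
have WX3 : W%:R ^+ 3 <= n%:R * L ^+ 5 / 16 by rewrite -X3 ler_pow3 // ler0n.
have Y1 : 10 * L * (L ^+ 4 / 2) * (n%:R / 2) ^+ 2 <= (t * (m - t) * (n - t) ^ 2)%:R.
  rewrite natrM natrX natrM; apply: ler_pM.
  - by rewrite !mulr_ge0 ?exprn_ge0 // invr_ge0.
  - by rewrite exprn_ge0 // divr_ge0.
  - by apply: ler_pM => //; [rewrite mulr_ge0|rewrite divr_ge0 // exprn_ge0].
  - by rewrite lerXn2r // nnegrE ?ler0n // divr_ge0.
have N2L5 : 0 < n%:R ^+ 2 * L ^+ 5 by rewrite mulr_gt0 // exprn_gt0 //; lra.
have Y1' : 10 * L * (L ^+ 4 / 2) * (n%:R / 2) ^+ 2 = 5 / 4 * (n%:R ^+ 2 * L ^+ 5) by field.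
(* With [expR 1 <= 4] the left side is at most half of [n%:R ^+ 2 * L ^+ 5], against [5 / 4] of it
   on the right. *)
have Y2 : expR 1 * (2 * n * W ^ 3)%:R <= (t * (m - t) * (n - t) ^ 2)%:R :> R.
  apply: le_trans Y1; rewrite Y1'.
  apply: (@le_trans _ _ (4 * (2 * n%:R * (n%:R * L ^+ 5 / 16)))).
    rewrite natrM natrX natrM.
    by apply: ler_pM; rewrite ?expR_ge0 ?expR1_le4 ?mulr_ge0 ?exprn_ge0 // ler_pM2l // mulr_gt0.
  rewrite (_ : 4 * _ = 1 / 2 * (n%:R ^+ 2 * L ^+ 5)); last by field.
  lra.
have Y3 : (0 < t * (m - t) * (n - t) ^ 2)%N.
  by rewrite -(ltr0n R); apply: lt_le_trans Y1; rewrite Y1'; lra.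
have := crowded_decay H Y2 Y3; set b := #|_| => Hb.
have et : expR (- t%:R) <= n%:R ^- 10 :> R.
  have -> : n%:R ^- 10 = expR (- (10%:R * L)) :> R.
    by rewrite expRN expRM_natl LE lnK // posrE.
  by rewrite ler_expR lerN2.
have n1 : 1 <= n%:R :> R by rewrite ler1n.
have n8 : 8 <= n%:R :> R by lra.
have F0 : 0 <= (n`! ^ 2)%:R :> R by exact: ler0n.
(* There are at most [2 * n ^ 3] windows, so [n ^- 10] leaves ample room for the factor [4 * n]. *)
apply: (@le_trans _ _ (2 * n%:R * n%:R ^+ 2 * (n`! ^ 2)%:R * n%:R ^- 10 * (4 * n%:R))).
  rewrite ler_wpM2r ?mulr_ge0 //; apply: (le_trans Hb).
  apply: ler_pM; rewrite ?mulr_ge0 ?expR_ge0 //.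
  rewrite ler_wpM2r // natrM natrX natrM; apply: ler_wpM2l; first by rewrite mulr_ge0.
  by rewrite lerXn2r // nnegrE.
rewrite (_ : _ * (4 * n%:R) = (n`! ^ 2)%:R * (8 * n%:R ^- 6)); last by field; rewrite gt_eqF.
rewrite -[X in _ <= X]mulr1 ler_wpM2l // ler_pdivrMr ?exprn_gt0 // mul1r.
by apply: (le_trans n8); rewrite ler_eXnr.
Qed.

Lemma not_evenly_spread_rare (R : realType) (n : nat) (L : R) : (0 < n)%N -> L = ln n%:R ->
  2 ^+ 22 <= L ->
  #|[set s : 'S_n | ~~ `[< evenly_spread L s >]]|%:R * (4 * n%:R) <= n`!%:R :> R.
Proof.
move=> n0 LE L22.
have L0 : 0 < L by apply: lt_le_trans L22; rewrite exprn_gt0.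
have N0 : 0 < n%:R :> R by rewrite ltr0n.
have N7 : 2 ^+ 7 <= n%:R :> R.
  apply: le_trans (ln_pow4_le n0 LE L22); rewrite -[X in X <= _]mulr1; apply: ler_pM => //.
  - by rewrite ler_weXn2l // ler1n.
  - by rewrite exprn_ege1 // (le_trans _ L22) // exprn_ege1 // ler1n.
have n1 : 1 <= n%:R :> R by rewrite ler1n.
have n2 : (n.+1 ^ 4)%:R <= (2 * n%:R) ^+ 4 :> R.
  by rewrite natrX lerXn2r ?nnegrE ?mulr_ge0 // -natr1 mulr_natl mulr2n lerD2l.
have eL : expR (- (16 * L)) = n%:R ^- 16 :> R.
  by rewrite expRN (expRM_natl 16) LE lnK // posrE.
have H := card_not_evenly_spread n L0; rewrite eL in H.
have F0 : 0 <= n`!%:R :> R by exact: ler0n.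
have i0 : 0 <= n%:R ^- 16 :> R by rewrite invr_ge0 exprn_ge0.
apply: (@le_trans _ _ ((2 * n%:R) ^+ 4 * (2 * n`!%:R * n%:R ^- 16) * (4 * n%:R))).
  rewrite ler_wpM2r ?mulr_ge0 //; apply: le_trans H _.
  by rewrite ler_wpM2r // !mulr_ge0.
rewrite (_ : _ * (4 * n%:R) = n`!%:R * (2 ^+ 7 * n%:R ^- 11)); last by field; rewrite gt_eqF.
rewrite -[X in _ <= X]mulr1 ler_wpM2l // ler_pdivrMr ?exprn_gt0 // mul1r.
by apply: (le_trans N7); rewrite ler_eXnr.
Qed.

(** * The bound on the expectation *)

(** There are three bad events: [s] is not evenly spread, [p] is not, or both are and [U] is large.
    Each has probability at most [1 / (4 * n)]. *)
Lemma expected_U_bound (R : realType) (n : nat) (L X : R) : (0 < n)%N -> L = ln n%:R ->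
  2 ^+ 22 <= L -> X = (n%:R * L ^+ 5 / 16) `^ (1 / 3) ->
  expected_U R n <= 2 ^+ 19 * X + 1.
Proof.
move=> n0 LE L22 XE.
have [B [BX crowded]] := crowded_spread_rare n0 LE L22 XE.
have sparse := not_evenly_spread_rare n0 LE L22.
set S := [set s : 'S_n | _] in sparse; set A := [set sp : 'S_n * 'S_n | _] in crowded.
apply: le_trans (_ : B%:R + 1 <= _); last by rewrite lerD2r.
apply: (@expected_U_le R n B (finset.setX S finset.setT :|: finset.setX finset.setT S :|: A)).
  move=> [s p]; rewrite !finset.in_setU !negb_or !finset.in_setX !finset.in_setT /= andbT.
  rewrite /S /A !finset.in_set !negbK => /andP[/andP[sS pS]] /=.
  by rewrite sS pS /= -leqNgt.
have card_le : (#|finset.setX S finset.setT :|: finset.setX finset.setT S :|: A| <=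
    2 * (#|S| * n`!) + #|A|)%N.
  apply: leq_trans (leq_card_setU _ _).1 _; rewrite leq_add2r mul2n -addnn.
  apply: leq_trans (leq_card_setU _ _).1 _.
  by rewrite !cardsX !cardsT !card_Sn leq_add // mulnC.
move: card_le; rewrite -(ler_nat R) natrD !natrM => card_le.
move: crowded; rewrite natrX => crowded.
apply: le_trans (ler_wpM2r (ler0n R n) card_le) _.
have F0 : 0 <= n`!%:R :> R by exact: ler0n.
have := ler_wpM2r F0 sparse; rewrite -expr2.
move: crowded; move: (#|S|%:R : R) (#|A|%:R : R) (n`!%:R : R) (n%:R : R) F0 => x y f N F0.
nra.
Qed.

Local Open Scope classical_set_scope.
Local Open Scope ring_scope.

Theorem corollary1p3 (R : realType) :
  exists2 C : R, 0 < C &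
    \forall n \near \oo,
      expected_U R n <= C * (n%:R `^ (1 / 3) * ln (n%:R) `^ (11 / 6)).
Proof.
(* The bound [2 ^+ 19 * X + 1] is at most [2 ^+ 19 * Y + Y], as [Y >= 1]. *)
exists (2 ^+ 20); first by rewrite exprn_gt0.
near=> n.
have nE : expR (2 ^+ 22) <= n%:R :> R by near: n; exact: nbhs_infty_ger.
have n0 : (0 < n)%N by rewrite -(ltr0n R); apply: lt_le_trans nE; exact: expR_gt0.
set L := ln n%:R.
have L22 : 2 ^+ 22 <= L by rewrite -ler_expR lnK // posrE ltr0n.
have L1 : 1 <= L by apply: le_trans L22; rewrite exprn_ege1 // ler1n.
have L0 : 0 <= L by apply: le_trans L1.
set Y := (_ `^ _ * _ `^ _).
have powR_ge1 (a r : R) : 1 <= a -> 0 <= r -> 1 <= a `^ r.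
  move=> a1 r0; have := @ge0_ler_powR R r r0 1 a; rewrite powR1; apply; rewrite ?nnegrE //.
  exact: le_trans a1.
have Y1 : 1 <= Y.
  by rewrite -[1]mulr1; apply: ler_pM => //; apply: powR_ge1; rewrite ?ler1n // divr_ge0.
(* The argument yields the exponent [5 / 3] of the logarithm; [L >= 1] lets [L ^+ 5] be replaced by
   the power [11 / 2], a third of which is [11 / 6]. *)
have XY : (n%:R * L ^+ 5 / 16) `^ (1 / 3) <= Y.
  have -> : Y = (n%:R * L `^ (11 / 2)) `^ (1 / 3).
    by rewrite powRM ?powR_ge0 // -powRrM /Y; congr (_ * _ `^ _); field.
  have third : 0 <= 1 / 3 :> R by rewrite divr_ge0.
  apply: (ge0_ler_powR third); rewrite ?nnegrE ?divr_ge0 ?mulr_ge0 ?exprn_ge0 ?powR_ge0 //.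
  apply: (@le_trans _ _ (n%:R * L ^+ 5)).
    by rewrite ler_pdivrMr // ler_peMr ?mulr_ge0 ?exprn_ge0 // (ler1n R 16).
  by rewrite ler_wpM2l // -powR_mulrn // ler_powR //; lra.
apply: le_trans (expected_U_bound n0 (erefl L) L22 erefl) _.
apply: (@le_trans _ _ (2 ^+ 19 * Y + Y)).
  by rewrite lerD // ler_wpM2l // exprn_ge0.
rewrite -[X in _ + X <= _]mul1r -mulrDl ler_wpM2r ?(le_trans _ Y1) //.
by rewrite [2 ^+ 20]exprS mulr_natl mulr2n lerD2l exprn_ege1 // (ler1n R 2).
Unshelve. all: by end_near.
Qed.
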